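(* Let $\omega\in\mathbb{R}^{\mathbb{Z}}$ satisfy $\omega\cdot\ell\neq 0$ for all $\ell\in\mathbb{Z}^{\mathbb{Z}}_f\setminus\{0\}$, and let $D_\omega=\sum_{j\in\mathbb{Z}}\omega_j|u_j|^2$. Let $H$ be any formal Hamiltonian of the form $$H=D_\omega+Z+R,\qquad Z\in\mathcal{K}^{\ge 2},\quad R\in\mathcal{F}^{\ge d},\quad d\ge 1 .$$ Then: (1) (Formal normal form) There exists $S\in\mathcal{F}^{\ge d}$ such that $$e^{\{S,\cdot\}}H=D_\omega+\widetilde Z,\qquad \widetilde Z-Z\in\mathcal{K}^{\ge d}.$$ (2) (Uniqueness) Let $S\in\mathcal{F}^{\ge d}$ be such that $e^{\{S,\cdot\}}H=D_\omega+\widetilde Z$ with $\widetilde Z-Z\in\mathcal{K}^{\ge d}$. If $G\in\mathcal{F}^{\ge 1}$ is such that $e^{\{G,\cdot\}}H\in\mathcal{K}$, then $e^{\{G,\cdot\}}H=e^{\{S,\cdot\}}H$. Hence to each formal Hamiltonian $H$ of the form $H=D_\omega+Z+R$ with $Z\in\mathcal{K}^{\ge 2}$, $R\in\mathcal{F}^{\ge d}$, $d\ge 1$, one can associate a unique $Z_H\in\mathcal{K}^{\ge 2}$ such that $e^{\{S,\cdot\}}H=D_\omega+Z_H$ (independently of the choice of $S\in\mathcal{F}^{\ge d}$ such that $e^{\{S,\cdot\}}H=D_\omega+\widetilde Z$ with $\widetilde Z-Z\in\mathcal{K}^{\ge d}$).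
   Context: $\mathbb{N}=\{0,1,2,\dots\}$. $\mathbb{N}^{\mathbb{Z}}_f$ (resp. $\mathbb{Z}^{\mathbb{Z}}_f$) denotes the finitely supported sequences of non-negative integers (resp. integers) indexed by $\mathbb{Z}$; $|k|=\sum_j|k_j|$; $\mathbf e_j$ is the sequence with $1$ at position $j$ and $0$ elsewhere; $u^\alpha=\prod_j u_j^{\alpha_j}$; $|u|^{2\alpha}=u^\alpha\bar u^\alpha$. For $\omega\in\mathbb{R}^{\mathbb Z}$ and $\ell\in\mathbb{Z}^{\mathbb Z}_f$, $\omega\cdot\ell=\sum_j\omega_j\ell_j$. $\pi(\alpha,\beta):=\sum_{j}j(\alpha_j-\beta_j)$ and $\mathcal{M}:=\{(\alpha,\beta)\in\mathbb{N}^{\mathbb{Z}}_f\times\mathbb{N}^{\mathbb{Z}}_f:\pi(\alpha,\beta)=0\}$. $\mathcal{F}$ is the (real vector) space of formal power series $H=\sum_{\alpha,\beta\in\mathbb{N}^{\mathbb{Z}}_f}H_{\alpha,\beta}u^\alpha\bar u^\beta$ (with $H_{\alpha,\beta}\in\mathbb{C}$, $u=(u_j)_{j\in\mathbb Z}$) such that: $H_{0,0}=H_{\mathbf e_0,0}=H_{0,\mathbf e_0}=0$; $H_{\alpha,\beta}=\overline{H_{\beta,\alpha}}$ for all $\alpha,\beta$ (reality); $H_{\alpha,\beta}=0$ whenever $\pi(\alpha,\beta)\neq0$ (momentum conservation). Elements of $\mathcal F$ are called formal Hamiltonians. $\mathcal{F}^{\ge d}$ is the set of $H\in\mathcal{F}$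 with $H_{\alpha,\beta}=0$ unless $|\alpha|+|\beta|\ge d+2$. $\mathcal{K}$ is the set of $Z\in\mathcal{F}$ of the form $Z=\sum_{\alpha}Z_{\alpha,\alpha}|u|^{2\alpha}$, and $\mathcal{K}^{\ge d}=\mathcal{K}\cap\mathcal{F}^{\ge d}$. Poisson bracket on $\mathcal F$: $$\{F,G\}=\mathrm{i}\sum_{(\alpha^{(1)},\beta^{(1)}),(\alpha^{(2)},\beta^{(2)})\in\mathcal{M}}F_{\alpha^{(1)},\beta^{(1)}}G_{\alpha^{(2)},\beta^{(2)}}\sum_j\big(\alpha^{(1)}_j\beta^{(2)}_j-\beta^{(1)}_j\alpha^{(2)}_j\big)u^{\alpha^{(1)}+\alpha^{(2)}-\mathbf e_j}\bar u^{\beta^{(1)}+\beta^{(2)}-\mathbf e_j}.$$ It satisfies $\{\mathcal F^{\ge d_1},\mathcal F^{\ge d_2}\}\subset\mathcal F^{\ge d_1+d_2}$. For $G\in\mathcal{F}^{\ge1}$, $\mathrm{ad}_G=\{G,\cdot\}$ and $e^{\{G,\cdot\}}=\sum_{k\ge0}\mathrm{ad}_G^k/k!$ (each homogeneous component of the result is a finite sum). *)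

(* Defs.v *)
From HB Require Import structures.
From mathcomp Require Import all_boot all_order all_algebra finmap.
From mathcomp Require Import boolp classical_sets functions cardinality fsbigop.
From mathcomp Require Import reals.
From mathcomp.real_closed Require Import complex.
From mathcomp.multinomials Require Import monalg.
From mathcomp Require Import zify.
Set Implicit Arguments.
Unset Strict Implicit.
Unset Printing Implicit Defensive.
Import Order.TTheory GRing.Theory Num.Theory.
Local Open Scope classical_set_scope.
Local Open Scope ring_scope.

(* [{cmonom int}] is the type of finitely supported functions int -> nat.  It
   is written multiplicatively in monalg: the sum of two multi-indices is
   [mmul], the zero multi-index is [mone], the multi-index e_j is [ucm j], and
   |alpha| is [mdeg alpha]. *)
Definition mindex := {cmonom int}.

(* An exponent pair (alpha, beta) stands for the monomial
   u^alpha * conj(u)^beta. *)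
Definition bindex := (mindex * mindex)%type.

Definition bdeg (m : bindex) : nat := (mdeg m.1 + mdeg m.2)%N.

Definition momentum (m : bindex) : int :=
  \sum_(j <- (finsupp m.1 `|` finsupp m.2)%fset)
    j * ((m.1 j)%:Z - (m.2 j)%:Z).

Definition zero_momentum : set bindex := [set m | momentum m = 0].

Definition wdot (R : realType) (w : int -> R) (l : {fsfun int -> int with 0}) : R :=
  \sum_(j <- finsupp l) w j * (l j)%:~R.

Definition nonresonant (R : realType) (w : int -> R) : Prop :=
  forall l : {fsfun int -> int with 0}, l <> [fsfun] -> wdot w l <> 0.

(* A formal power series in (u, conj u) is its family of coefficients; the
   linear structure is the pointwise one. *)
Definition series (R : realType) : Type := bindex -> R[i].
HB.instance Definition _ (R : realType) := GRing.Zmodule.on (series R).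

Definition formal_ham (R : realType) : set (series R) := [set H |
  [/\ H (mone, mone) = 0,
      H (ucm 0, mone) = 0 /\ H (mone, ucm 0) = 0,
      forall m : bindex, H m = (H (m.2, m.1))^*
    & forall m : bindex, momentum m <> 0 -> H m = 0]].

Definition formal_ham_ge (R : realType) (d : nat) : set (series R) := [set H |
  formal_ham H /\ forall m : bindex, ~~ (d + 2 <= bdeg m)%N -> H m = 0].

Definition integrable_ham (R : realType) : set (series R) := [set Z |
  formal_ham Z /\ forall m : bindex, m.1 <> m.2 -> Z m = 0].

Definition integrable_ham_ge (R : realType) (d : nat) : set (series R) :=
  @integrable_ham R `&` @formal_ham_ge R d.

Definition quad_ham (R : realType) (w : int -> R) : series R := fun m =>
  \sum_(j \in [set: int])
    ((w j)%:C)%C * (m == (ucm j, ucm j) :> bindex)%:R.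

(* Triples ((p, q), j) with p, q in M contributing to the monomial m.  The
   condition p + q - (e_j, e_j) = m is written without subtraction: when
   p + q - (e_j, e_j) has a negative entry, [bracket_factor] vanishes. *)
Definition bracket_support (m : bindex) : set (bindex * bindex * int) :=
  [set t | [/\ zero_momentum t.1.1, zero_momentum t.1.2,
    mmul t.1.1.1 t.1.2.1 = mmul m.1 (ucm t.2) &
    mmul t.1.1.2 t.1.2.2 = mmul m.2 (ucm t.2)]].

Definition bracket_factor (t : bindex * bindex * int) : int :=
  (t.1.1.1 t.2)%:Z * (t.1.2.2 t.2)%:Z - (t.1.1.2 t.2)%:Z * (t.1.2.1 t.2)%:Z.

(* [\sum_(t \in A) f t] is 0 by convention if f has infinite support in A; the
   lemma [bracket_finite] below shows that this never happens here. *)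
Definition bracket (R : realType) (F G : series R) : series R := fun m =>
  'i * \sum_(t \in bracket_support m)
         F t.1.1 * G t.1.2 * (bracket_factor t)%:~R.

(* Also a finite sum for G in F^{>=1} and H in F, see [exp_ad_finite]. *)
Definition exp_ad (R : realType) (G H : series R) : series R := fun m =>
  \sum_(k \in [set: nat]) (k`!%:R)^-1 * iter k (bracket G) H m.

Lemma finite_mindex (D : {fset int}) (N : nat) :
  finite_set [set a : mindex | (finsupp a `<=` D)%fset /\ forall i, (a i <= N)%N].
Proof.
pose g (f : {ffun D -> 'I_N.+1}) : mindex :=
  mkcmonom [fsfun x : D => nat_of_ord (f x) | 0%N].
apply: (@sub_finite_set _ _ (g @` [set: {ffun D -> 'I_N.+1}])); last first.
  by apply: finite_image; exact: finite_finset.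
move=> a [aD aN] /=.
exists [ffun x : D => inord (a (val x))] => //.
apply/eqP/cmP => i; rewrite cmE fsfun_ffun.
case: insubP => [u _ ui|] /=.
  by rewrite ffunE inordK ?ui// ltnS.
move=> iD; apply/esym/eqP; rewrite cmE_eq0.
by apply: contra iD => /(fsubsetP aD).
Qed.

Lemma finite_int (B : nat) : finite_set [set j : int | (`|j| <= B)%N].
Proof.
apply: (@sub_finite_set _ _
  ((fun n : nat => n%:Z) @` `I_B.+1 `|` (fun n : nat => - n%:Z) @` `I_B.+1)).
  move=> j /= jB; have [j0|j0] := leP 0 j.
    by left; exists `|j|%N => /=; lia.
  by right; exists `|j|%N => /=; lia.
by rewrite finite_setU; split; apply: finite_image; exact: finite_II.
Qed.

Lemma momentumEw (m : bindex) (D : {fset int}) :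
  (finsupp m.1 `|` finsupp m.2 `<=` D)%fset ->
  momentum m = \sum_(j <- D) j * ((m.1 j)%:Z - (m.2 j)%:Z).
Proof.
move=> sD; rewrite /momentum; apply: big_fset_incl sD _ => j _.
rewrite in_fsetU negb_or !memNfinsupp => /andP[/eqP -> /eqP ->].
by rewrite subrr mulr0.
Qed.

Definition support_bound (m : bindex) : nat :=
  \sum_(i <- (finsupp m.1 `|` finsupp m.2)%fset) `|i| * (m.1 i + m.2 i).

Lemma bracket_index_bound (m : bindex) (t : bindex * bindex * int) :
  bracket_support m t -> bracket_factor t != 0 ->
  t.2 \in (finsupp m.1 `|` finsupp m.2)%fset \/ (`|t.2| <= support_bound m)%N.
Proof.
case: m => a b; case: t => [[[p1 p2] [q1 q2]] j].
rewrite /bracket_support /bracket_factor /zero_momentum /= => -[Mp _ Ea Eb] nz.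
set D := (finsupp a `|` finsupp b)%fset.
have [jD|jD] := boolP (j \in D); [by left|right].
have Ea' i : (p1 i + q1 i = a i + (j == i))%N.
  by rewrite -cmM Ea cmM cmU.
have Eb' i : (p2 i + q2 i = b i + (j == i))%N.
  by rewrite -cmM Eb cmM cmU.
have [aj bj] : a j = 0%N /\ b j = 0%N.
  by move: jD; rewrite in_fsetU negb_or !memNfinsupp => /andP[/eqP -> /eqP ->].
have pj : `|(p1 j)%:Z - (p2 j)%:Z|%N = 1%N.
  move: (Ea' j) (Eb' j) nz; rewrite aj bj eqxx /=.
  case: (p1 j) => [|[|?]]; case: (p2 j) => [|[|?]]; case: (q1 j) => [|[|?]];
    case: (q2 j) => [|[|?]] //=; lia.
have sD : (finsupp p1 `|` finsupp p2 `<=` j |` D)%fset.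
  apply/fsubsetP => i; rewrite !in_fsetU in_fset1 -!cmE_neq0.
  have [//|ij] := eqVneq i j; move: (Ea' i) (Eb' i).
  rewrite [j == i]eq_sym (negbTE ij) !addn0 /= => <- <-.
  rewrite !addn_eq0 !negb_and.
  by case/orP => ->; rewrite ?orbT.
move: Mp; rewrite (@momentumEw (p1, p2) _ sD) /= big_fsetU1 //=.
move/eqP; rewrite addr_eq0 => /eqP E.
have -> : `|j|%N = `|(j * ((p1 j)%:Z - (p2 j)%:Z))%R|%N by rewrite abszM pj muln1.
rewrite E abszN /support_bound /= -/D.
suff H (s : seq int) : {subset s <= D} ->
  (`|(\sum_(i <- s) i * ((p1 i)%:Z - (p2 i)%:Z))%R|
   <= \sum_(i <- s) `|i| * (a i + b i))%N by exact: H.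
elim: s => [|i s IH] sub; first by rewrite !big_nil.
have iD : i \in D by apply: sub; rewrite mem_head.
have ji : (j == i) = false by apply: contraNF jD => /eqP ->.
have IHs : {subset s <= D} by move=> x xs; apply: sub; rewrite in_cons xs orbT.
rewrite !big_cons; move: (IH IHs) (Ea' i) (Eb' i); rewrite ji !addn0 => {}IH Ei Fi.
have : (`|(i * ((p1 i)%:Z - (p2 i)%:Z))%R| <= `|i| * (a i + b i))%N.
  by rewrite abszM leq_mul2l; apply/orP; right; lia.
have tri (x y : int) (u v : nat) :
  (`|x| <= u -> `|y| <= v -> `|(x + y)%R| <= u + v)%N by lia.
by move=> h; exact: tri.
Qed.

Lemma bracket_finite (R : realType) (F G : series R) (m : bindex) :
  finite_set (bracket_support m `&`
    (fun t => F t.1.1 * G t.1.2 * (bracket_factor t)%:~R) @^-1` [set~ 0]).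
Proof.
pose D := (finsupp m.1 `|` finsupp m.2)%fset.
pose J := [set` D] `|` [set j : int | (`|j| <= support_bound m)%N].
have fJ : finite_set J by rewrite finite_setU; split; [exact: finite_fset|exact: finite_int].
pose A j := [set a : mindex | (finsupp a `<=` j |` D)%fset /\
              forall i, (a i <= (mdeg m.1 + mdeg m.2).+1)%N].
pose B j : set (bindex * bindex * int) :=
  ((A j `*` A j) `*` (A j `*` A j)) `*` [set j].
apply: (@sub_finite_set _ _ (\bigcup_(j in J) B j)); last first.
  apply: bigcup_finite => // j _.
  by repeat apply: finite_setX => //; exact: finite_mindex.
move=> t [tm /= nz].
have fn : bracket_factor t != 0.
  by apply/eqP => f0; apply: nz; rewrite f0 mulr0.
have tJ : J t.2 by case: (bracket_index_bound tm fn) => h; [left|right].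
exists t.2 => //; case: tm => _ _ E1 E2.
have le_mdeg (a : mindex) i : (a i <= mdeg a)%N.
  have [->//|] := eqVneq (a i) 0%N; rewrite cmE_neq0 => h.
  by rewrite mdegE (big_fsetD1 i)//= leq_addr.
have bnd (c x y : mindex) : (finsupp c `<=` D)%fset -> (mdeg c <= mdeg m.1 + mdeg m.2)%N ->
    mmul x y = mmul c (ucm t.2) -> A t.2 x /\ A t.2 y.
  move=> cD cm E.
  have E' i : (x i + y i = c i + (t.2 == i))%N by rewrite -cmM E cmM cmU.
  have sub : (finsupp x `|` finsupp y `<=` t.2 |` D)%fset.
    rewrite -mdomD E mdomD mdomU fsetUC fsetUS//.
  move: sub; rewrite fsubUset => /andP[sx sy].
  by split; split => // i; move: (E' i) (le_mdeg c i); case: (_ == _) => /=; lia.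
have [A1 A2] := bnd _ _ _ (fsubsetUl _ _) (leq_addr _ _) E1.
have [A3 A4] := bnd _ _ _ (fsubsetUr _ _) (leq_addl _ _) E2.
by [].
Qed.

Lemma bdeg_bracket_support (m : bindex) (t : bindex * bindex * int) :
  bracket_support m t -> (bdeg t.1.1 + bdeg t.1.2 = bdeg m + 2)%N.
Proof.
case=> _ _ /(congr1 mdeg) E1 /(congr1 mdeg) E2; move: E1 E2.
by rewrite !mdegM !mdegU /bdeg => E1 E2; rewrite addnACA E1 E2 addnACA.
Qed.

Lemma bracket_low (R : realType) (d e : nat) (F G : series R) :
  (forall m, ~~ (d + 2 <= bdeg m)%N -> F m = 0) ->
  (forall m, ~~ (e + 2 <= bdeg m)%N -> G m = 0) ->
  forall m, ~~ (d + e + 2 <= bdeg m)%N -> bracket F G m = 0.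
Proof.
move=> F0 G0 m md; rewrite /bracket fsbig1 ?mulr0// => t tm.
have tE := bdeg_bracket_support tm.
have [tF|tF] := leqP (d + 2)%N (bdeg t.1.1); last first.
  by rewrite F0 ?mul0r// -ltnNge.
by rewrite G0 ?mulr0 ?mul0r//; move: (bdeg m) (bdeg t.1.1) (bdeg t.1.2) md tE tF; lia.
Qed.

Lemma formal_ham_low (R : realType) (H : series R) :
  formal_ham H -> formal_ham_ge 0 H.
Proof.
move=> FH; split=> // -[a b]; case: (FH) => H00 [H10 H01] _ Hmom.
rewrite /bdeg /= -ltnNge add0n => ab.
have single (c : mindex) : mdeg c = 1%N -> exists j, c = ucm j.
  move=> c1.
  have c0 : c != mone by rewrite -mdeg_eq0 c1.
  have [j cj] : exists j, c j != 0%N.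
    apply: contrapT => /forallNP nj; move/negP: c0; apply; apply/cmP => i.
    by rewrite cm1; apply/eqP; apply: contrapT => /negP; exact: nj.
  exists j; have cE : c = mmul (divcm c (ucm j)) (ucm j).
    apply/eqP/cmP => i; rewrite cmM divcmE cmU subnK//.
    by case: eqVneq => [<-|//]; rewrite lt0n.
  move: c1; rewrite cE mdegM mdegU addn1 => -[] /eqP; rewrite mdeg_eq0 => /eqP ->.
  by rewrite mul1m.
have momU j (m : bindex) : m = (ucm j, mone) \/ m = (mone, ucm j) ->
    momentum m = j \/ momentum m = - j.
  case=> ->; [left|right]; rewrite (@momentumEw _ [fset j]%fset) /=;
    rewrite ?mdomU ?mdom1 ?fsetU0 ?fset0U// big_seq_fset1 cm1 cmUU;
    by rewrite ?subr0 ?sub0r ?mulr1 ?mulrN1.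
have caseU j (m : bindex) : m = (ucm j, mone) \/ m = (mone, ucm j) -> H m = 0.
  move=> mE; have [j0|/eqP j0] := eqVneq j 0; last first.
    by apply: Hmom; case: (momU _ _ mE) => ->; lia.
  by case: mE => ->; rewrite j0.
have [a0|a1] : mdeg a = 0%N \/ mdeg a = 1%N by move: (mdeg a) (mdeg b) ab; lia.
  move/eqP: a0; rewrite mdeg_eq0 => /eqP a0.
  have [b0|b1] : mdeg b = 0%N \/ mdeg b = 1%N.
    by move: (mdeg a) (mdeg b) ab; lia.
    by move/eqP: b0; rewrite mdeg_eq0 => /eqP ->; rewrite a0.
  have [j bj] := single _ b1; apply: (caseU j); right; by rewrite a0 bj.
have [j aj] := single _ a1; apply: (caseU j); left.
suff /eqP : mdeg b == 0%N by move/eqP; rewrite mdeg_eq0 => /eqP ->; rewrite aj.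
by apply/eqP; move: ab; rewrite a1; move: (mdeg b); lia.
Qed.

Lemma exp_ad_finite (R : realType) (G H : series R) (m : bindex) :
  formal_ham_ge 1 G -> formal_ham H ->
  finite_set ([set: nat] `&`
    (fun k => (k`!%:R)^-1 * iter k (bracket G) H m) @^-1` [set~ 0]).
Proof.
move=> [_ G0] /formal_ham_low[_ H0].
have low k : forall m', ~~ (k + 2 <= bdeg m')%N -> iter k (bracket G) H m' = 0.
  elim: k => [|k IH] m' /= mk; first exact: H0.
  by apply: (bracket_low G0 IH); rewrite add1n.
apply: (@sub_finite_set _ _ `I_(bdeg m)); last exact: finite_II.
move=> k [_ /= nz]; rewrite ltnNge; apply/negP => mk; apply: nz.
by rewrite low ?mulr0//; lia.
Qed.

Lemma quad_hamE (R : realType) (w : int -> R) (j : int) :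
  quad_ham w (ucm j, ucm j) = (w j)%:C%C.
Proof.
rewrite /quad_ham (fsbigTE [fset j]%fset) => [|i].
  by rewrite big_seq_fset1 eqxx mulr1.
rewrite in_fset1 => ij; case: eqP => [[/eqP/cmP /(_ i)]|_]; last by rewrite mulr0.
by rewrite cmUU cmU eq_sym (negbTE ij).
Qed.

Lemma quad_ham_eq0 (R : realType) (w : int -> R) (m : bindex) :
  (forall j, m <> (ucm j, ucm j)) -> quad_ham w m = 0.
Proof.
by move=> mj; rewrite /quad_ham fsbig1// => i _; case: eqP => [/mj//|_]; rewrite mulr0.
Qed.

Lemma quad_ham_integrable (R : realType) (w : int -> R) :
  integrable_ham (quad_ham w).
Proof.
have U1 (i : int) : ucm i <> mone by move=> /(congr1 mdeg); rewrite mdegU mdeg1.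
split; last first.
  by case=> a b /= ab; apply: quad_ham_eq0 => j [aj bj]; apply: ab; rewrite aj bj.
split.
- by apply: quad_ham_eq0 => j [/esym/U1].
- by split; apply: quad_ham_eq0 => j; [move=> [_ /esym/U1]|move=> [/esym/U1]].
- case=> a b /=; have [[j [-> ->]]|nj] := pselect (exists j, (a, b) = (ucm j, ucm j)).
    by rewrite quad_hamE; apply/esym/eqP; rewrite eq_complex /= eqxx oppr0 eqxx.
  rewrite !quad_ham_eq0 ?rmorph0// => j [aj bj]; apply: nj; exists j; by rewrite aj bj.
- move=> m mm; apply: quad_ham_eq0 => j mE; apply: mm; rewrite mE.
  by rewrite /momentum big1// => i _; rewrite subrr mulr0.
Qed.

(* Main.v *)
(* Solving degree by degree, for every prescribed diagonal part Q there is exactly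
   one generator G with diagonal part Q such that e^{G,.} H has no off-diagonal
   part: the component of degree n of e^{G,.} H is {G_n, D_w} plus terms in the
   G_k with k < n, and ad_{D_w} is invertible off the diagonal by nonresonance.
   Existence is the case Q = 0, and the reality of S follows from uniqueness.

   To compare two generators S and G, interpolate linearly between their diagonal
   parts; this gives generators G_t, polynomial in t coefficient by coefficient,
   with G_0 = S, G_1 = G and K_t = e^{G_t,.} H diagonal for all t.  By Duhamel's
   formula dK_t/dt = {W_t, K_t} for some W_t.  The bracket of any series with a
   diagonal one has no diagonal part, while dK_t/dt is diagonal, so K_t does not
   depend on t.  To have t as a formal parameter, series take coefficients in an
   arbitrary ring A over C, specialised to A = C and A = C[t]. *)
Require Import Defs.
From mathcomp Require Import all_boot all_order all_algebra finmap.
From mathcomp Require Import boolp classical_sets functions cardinality fsbigop.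
From mathcomp Require Import reals.
From mathcomp.real_closed Require Import complex.
From mathcomp.multinomials Require Import monalg.
From mathcomp Require Import zify ring.
Set Implicit Arguments.
Unset Strict Implicit.
Unset Printing Implicit Defensive.
Import Order.TTheory GRing.Theory Num.Theory.
Local Open Scope ring_scope.

(** * Structure constants of the Poisson bracket *)

Definition badd (p q : bindex) : bindex := (mmul p.1 q.1, mmul p.2 q.2).
Definition bunit (j : int) : bindex := (ucm j, ucm j).
Definition bswap (p : bindex) : bindex := (p.2, p.1).
Definition bsupp (p : bindex) : {fset int} := (finsupp p.1 `|` finsupp p.2)%fset.

Definition wedge (p q : bindex) (j : int) : int :=
  (p.1 j)%:Z * (q.2 j)%:Z - (p.2 j)%:Z * (q.1 j)%:Z.

(* The structure constants of the bracket: [i * cf p q m] is the coefficient of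
   the monomial m in the bracket of the monomials p and q. *)
Definition cf (p q m : bindex) : int :=
  if (momentum p == 0) && (momentum q == 0) then
    \sum_(j <- bsupp p) wedge p q j *+ (badd p q == badd m (bunit j))
  else 0.

Lemma mindexP (a b : mindex) : (forall i, a i = b i :> nat) -> a = b.
Proof. by move=> ab; apply/eqP/cmP. Qed.

Lemma baddP (p q r s : bindex) : reflect
  (forall i, p.1 i + q.1 i = r.1 i + s.1 i /\ p.2 i + q.2 i = r.2 i + s.2 i)%N
  (badd p q == badd r s).
Proof.
apply: (iffP eqP) => [[/eqP/cmP E1 /eqP/cmP E2] i|E].
  by move: (E1 i) (E2 i); rewrite !cmM.
by congr pair; apply: mindexP => i; rewrite !cmM; case: (E i).
Qed.

Implicit Types p q r m n : bindex.

Lemma baddC p q : badd p q = badd q p.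
Proof. by apply/eqP/baddP => i; split; lia. Qed.

Lemma baddA p q r : badd p (badd q r) = badd (badd p q) r.
Proof. by apply/eqP/baddP => i /=; rewrite !cmM !addnA. Qed.

Lemma badd_eqr p q r : (badd p r == badd q r) = (p == q).
Proof.
apply/idP/eqP => [/baddP E|->//].
case: p q E => [p1 p2] [q1 q2] /= E; congr pair; apply: mindexP => i;
  by case: (E i) => /addIn ? /addIn ?.
Qed.

Lemma bsuppP p j : reflect (p.1 j = 0%N /\ p.2 j = 0%N) (j \notin bsupp p).
Proof.
rewrite in_fsetU negb_or -!cmE_eq0.
by apply: (iffP andP) => [[/eqP a /eqP b]|[-> ->]].
Qed.

Lemma bsupp_badd p q : bsupp (badd p q) = (bsupp p `|` bsupp q)%fset.
Proof. by rewrite /bsupp /= !mdomD fsetUACA. Qed.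

Lemma momentum_badd p q : momentum (badd p q) = momentum p + momentum q.
Proof.
pose J := (bsupp p `|` bsupp q)%fset.
have pqJ : (bsupp (badd p q) `<=` J)%fset by rewrite bsupp_badd.
rewrite (@momentumEw _ J)//.
rewrite (@momentumEw p J) ?fsubsetUl// (@momentumEw q J) ?fsubsetUr//.
rewrite -big_split /=; apply: eq_bigr => j _.
by rewrite !cmM !PoszD; ring.
Qed.

Lemma momentum_bunit j : momentum (bunit j) = 0.
Proof. by rewrite /momentum big1// => i _; rewrite subrr mulr0. Qed.

Lemma momentum_bswap p : momentum (bswap p) = - momentum p.
Proof.
rewrite /momentum /= fsetUC -sumrN; apply: eq_bigr => j _.
by rewrite -mulrN opprB.
Qed.

Lemma bdeg_badd p q : bdeg (badd p q) = (bdeg p + bdeg q)%N.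
Proof. by rewrite /bdeg /= !mdegM addnACA. Qed.

Lemma bdeg_bunit j : bdeg (bunit j) = 2%N.
Proof. by rewrite /bdeg /= !mdegU. Qed.

Lemma wedge_bsuppl p q j : j \notin bsupp p -> wedge p q j = 0.
Proof. by move=> /bsuppP[E1 E2]; rewrite /wedge E1 E2 !mul0r subrr. Qed.

Lemma wedgeC p q j : wedge p q j = - wedge q p j.
Proof. by rewrite /wedge; ring. Qed.

Lemma cfE (J : {fset int}) p q m : (bsupp p `<=` J)%fset ->
  momentum p = 0 -> momentum q = 0 ->
  cf p q m = \sum_(j <- J) wedge p q j *+ (badd p q == badd m (bunit j)).
Proof.
move=> sJ p0 q0; rewrite /cf p0 q0 eqxx; apply: big_fset_incl => // j _ jp.
by rewrite wedge_bsuppl// mul0rn.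
Qed.

Lemma cf_neq0 p q m : cf p q m != 0 -> [/\ momentum p = 0, momentum q = 0 &
  exists2 j, wedge p q j != 0 & badd p q = badd m (bunit j)].
Proof.
rewrite /cf; case: ifP => [/andP[/eqP p0 /eqP q0] nz|]; last by rewrite eqxx.
split => //; apply: contrapT => nj; case/eqP: nz.
rewrite big1_seq// => j _; have [w0|w0] := eqVneq (wedge p q j) 0.
  by rewrite w0 mul0rn.
by case: eqP => // E; case: nj; exists j.
Qed.

Lemma cf_bdeg p q m : cf p q m != 0 -> (bdeg p + bdeg q = bdeg m + 2)%N.
Proof.
by move=> /cf_neq0[_ _ [j _ /(congr1 bdeg)]]; rewrite !bdeg_badd bdeg_bunit.
Qed.

Lemma cf_momentum p q m : cf p q m != 0 -> momentum m = 0.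
Proof.
move=> /cf_neq0[p0 q0 [j _ /(congr1 momentum)]].
by rewrite !momentum_badd momentum_bunit p0 q0 !addr0 => <-.
Qed.

Lemma cfC p q m : cf p q m = - cf q p m.
Proof.
have [p0|p0] := eqVneq (momentum p) 0; last first.
  by rewrite /cf (negbTE p0) andbF oppr0.
have [q0|q0] := eqVneq (momentum q) 0; last first.
  by rewrite /cf (negbTE q0) andbF oppr0.
rewrite (@cfE (bsupp p `|` bsupp q)%fset p q) ?fsubsetUl//.
rewrite (@cfE (bsupp p `|` bsupp q)%fset q p) ?fsubsetUr//.
rewrite -sumrN; apply: eq_bigr => j _.
by rewrite wedgeC baddC mulNrn.
Qed.

Lemma badd_bswap p q : badd (bswap p) (bswap q) = bswap (badd p q).
Proof. by []. Qed.

(** Exchanging u with its conjugate changes the sign of every wedge; the reality of the bracket in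
    [star_bracket] comes from this sign. *)
Lemma cf_bswap p q m : cf (bswap p) (bswap q) (bswap m) = - cf p q m.
Proof.
rewrite /cf !momentum_bswap !oppr_eq0; case: ifP => _; last by rewrite oppr0.
have -> : bsupp (bswap p) = bsupp p by rewrite /bsupp fsetUC.
rewrite -sumrN; apply: eq_bigr => j _.
have -> : wedge (bswap p) (bswap q) j = - wedge p q j by rewrite /wedge /=; ring.
rewrite mulNrn; congr (- (_ *+ nat_of_bool _)).
rewrite -[bunit j]/(bswap (bunit j)) !badd_bswap.
by rewrite /bswap; apply/eqP/eqP => -[E1 E2]; congr pair.
Qed.

(** With q and m diagonal, p + q = m + (e_j, e_j) forces p.1 j = p.2 j, so the wedge at j vanishes.
    The uniqueness of the normal form rests on this cancellation. *)
Lemma cf_diag p q m : q.1 = q.2 -> m.1 = m.2 -> cf p q m = 0.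
Proof.
move=> qd md; apply/eqP/negP => /negP /cf_neq0[_ _ [j wj /eqP/baddP E]].
case/eqP: wj; rewrite /wedge qd.
have -> : p.1 j = p.2 j by case: (E j); rewrite qd md => <- /addIn.
by rewrite subrr.
Qed.

(** A nonzero wedge at j makes both components of p + q positive at j, so the truncated subtraction
    of e_j in the witness is exact. *)
Lemma wedge_sub p q j : wedge p q j != 0 ->
  exists n, badd p q = badd n (bunit j).
Proof.
move=> wj; exists (divcm (mmul p.1 q.1) (ucm j), divcm (mmul p.2 q.2) (ucm j)).
apply/eqP/baddP => i /=; rewrite !divcmE !cmM !cmU.
case: eqVneq => [<-|_] /=; last by rewrite !subn0 !addn0.
suff /andP[h1 h2] : (0 < p.1 j + q.1 j)%N && (0 < p.2 j + q.2 j)%N by rewrite !subnK.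
apply: contraR wj; rewrite /wedge.
by rewrite negb_and -!leqNgt !leqn0 !addn_eq0 => /orP[]/andP[/eqP -> /eqP ->];
  apply/eqP; ring.
Qed.

(** For each j with nonzero wedge only n = p + q - (e_j, e_j) contributes, so the sum over n
    collapses. The term with j == k records the removal of e_j from n inside the second wedge. *)
Lemma cf_comp (J : {fset int}) (N : {fset bindex}) p q r m :
  momentum p = 0 -> momentum q = 0 -> momentum r = 0 ->
  (bsupp p `<=` J)%fset -> (bsupp q `<=` J)%fset ->
  (forall n, cf n r m != 0 -> n \in N) ->
  \sum_(n <- N) cf p q n * cf n r m =
  \sum_(j <- J) \sum_(k <- J)
    (wedge p q j * (wedge p r k + wedge q r k
       - ((r.2 k)%:Z - (r.1 k)%:Z) *+ (j == k)))
    *+ (badd (badd p q) r == badd (badd m (bunit j)) (bunit k)).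
Proof.
move=> p0 q0 r0 pJ qJ hN.
under eq_bigr do rewrite (cfE _ pJ p0 q0) mulr_suml.
rewrite exchange_big /=; apply: eq_bigr => j _.
have [w0|/wedge_sub[n0 En]] := eqVneq (wedge p q j) 0.
  rewrite [LHS]big1 => [|n _]; last by rewrite w0 mul0rn mul0r.
  by rewrite [RHS]big1 => [|k _] //; rewrite w0 mul0r mul0rn.
have n00 : momentum n0 = 0.
  by move/(congr1 momentum): En; rewrite !momentum_badd momentum_bunit p0 q0 !addr0.
have n0J : (bsupp n0 `<=` J)%fset.
  have : (bsupp (badd p q) `<=` J)%fset by rewrite bsupp_badd fsubUset pJ.
  by rewrite En bsupp_badd fsubUset => /andP[].
transitivity (wedge p q j * cf n0 r m).
  under eq_bigr => n _ do rewrite En badd_eqr eq_sym.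
  have [n0N|n0N] := boolP (n0 \in N).
    rewrite (big_fsetD1 n0)//= eqxx mulr1n big1_seq ?addr0// => n.
    by rewrite !inE => /andP[_ /andP[/negbTE -> _]]; rewrite mulr0n mul0r.
  rewrite big1_seq => [|n /andP[_ nN]].
    by case: (eqVneq (cf n0 r m) 0) => [->|/hN]; rewrite ?mulr0// (negbTE n0N).
  by case: eqVneq => [E|_]; [rewrite -E nN in n0N|rewrite mulr0n mul0r].
rewrite (cfE _ n0J n00 r0) mulr_sumr; apply: eq_bigr => k _.
have -> : (badd (badd p q) r == badd (badd m (bunit j)) (bunit k)) =
          (badd n0 r == badd m (bunit k)).
  rewrite En -[badd (badd n0 _) r]baddA [badd (bunit j) r]baddC baddA.
  by rewrite -[badd (badd m _) _]baddA [badd (bunit j) _]baddC baddA badd_eqr.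
rewrite mulrnAr; congr (_ * _ *+ _).
move/eqP/baddP: En => /(_ k) /=; rewrite cmU => -[E1 E2].
have {}E1 : (n0.1 k)%:Z = (p.1 k)%:Z + (q.1 k)%:Z - (j == k)%:Z.
  by rewrite -PoszD E1 PoszD addrK.
have {}E2 : (n0.2 k)%:Z = (p.2 k)%:Z + (q.2 k)%:Z - (j == k)%:Z.
  by rewrite -PoszD E2 PoszD addrK.
rewrite /wedge E1 E2; case: (j == k) => /=; ring.
Qed.

Lemma cf_jacobi (N : {fset bindex}) p q r m :
  (forall n s, cf n s m != 0 -> n \in N) ->
  \sum_(n <- N) cf p q n * cf n r m + \sum_(n <- N) cf q r n * cf n p m
  + \sum_(n <- N) cf r p n * cf n q m = 0.
Proof.
move=> hN.
have zl x y z : momentum x != 0 -> \sum_(n <- N) cf x y n * cf n z m = 0.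
  by move=> /negbTE x0; rewrite big1// => n _; rewrite /cf x0 mul0r.
have zm x y z : momentum y != 0 -> \sum_(n <- N) cf x y n * cf n z m = 0.
  by move=> /negbTE x0; rewrite big1// => n _; rewrite /cf x0 andbF mul0r.
have zr x y z : momentum z != 0 -> \sum_(n <- N) cf x y n * cf n z m = 0.
  by move=> /negbTE x0; rewrite big1// => n _; rewrite /cf x0 !andbF mulr0.
have add3 (a b c : int) : a = 0 -> b = 0 -> c = 0 -> a + b + c = 0.
  by move=> -> -> ->.
have [p0|p0] := eqVneq (momentum p) 0; last first.
  by apply: add3; [exact: zl|exact: zr|exact: zm].
have [q0|q0] := eqVneq (momentum q) 0; last first.
  by apply: add3; [exact: zm|exact: zl|exact: zr].
have [r0|r0] := eqVneq (momentum r) 0; last first.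
  by apply: add3; [exact: zr|exact: zm|exact: zl].
pose J := (bsupp p `|` bsupp q `|` bsupp r)%fset.
have pJ : (bsupp p `<=` J)%fset by rewrite /J -fsetUA fsubsetUl.
have qJ : (bsupp q `<=` J)%fset by rewrite /J fsetUAC fsubsetUr.
have rJ : (bsupp r `<=` J)%fset by rewrite /J fsubsetUr.
have hN' s n : cf n s m != 0 -> n \in N by exact: hN.
have E1 := cf_comp p0 q0 r0 pJ qJ (hN' r).
have E2 := cf_comp q0 r0 p0 qJ rJ (hN' p).
have E3 := cf_comp r0 p0 q0 rJ pJ (hN' q).
apply: (eq_trans (congr2 +%R (congr2 +%R E1 E2) E3)).
rewrite -!big_split /=; under eq_bigr do rewrite -!big_split /=.
set X := (LHS).
(* Apart from the corrections at j = k, which cancel cyclically, the cyclic sum is antisymmetric in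
   (j, k). So X is added to itself with j and k exchanged, and the terms cancel pointwise. *)
suff : X + X = 0 by lia.
rewrite {2}/X exchange_big /= -!big_split /= big1// => j _.
rewrite -big_split /= big1// => k _.
have -> : badd (badd q r) p = badd (badd p q) r by rewrite -[RHS]baddA [RHS]baddC.
have -> : badd (badd r p) q = badd (badd p q) r by rewrite -baddA [LHS]baddC.
have -> : badd (badd m (bunit k)) (bunit j) = badd (badd m (bunit j)) (bunit k).
  by rewrite -baddA [badd (bunit k) _]baddC baddA.
case: (badd _ _ == _); last by rewrite !mulr0n !addr0.
rewrite !mulr1n [k == j]eq_sym /wedge; case: eqVneq => [->|_];
  rewrite ?mulr1n ?mulr0n; ring.
Qed.

(** * The bracket of series with coefficients in a ring *)

Section Bracket.
Context (R : realType).
Local Notation C := R[i].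

Lemma finite_bdom m :
  finite_set [set p : bindex | exists q, cf p q m != 0]%classic.
Proof.
(* With all coefficients equal to 1, the summands counted by [bracket_finite] are nonzero exactly
   where [bracket_factor] is. *)
have := finite_image (fun t : bindex * bindex * int => t.1.1)
  (bracket_finite (fun=> 1 : C) (fun=> 1 : C) m).
apply: sub_finite_set => p [q pq].
have [p0 q0 [j wj /eqP/baddP E]] := cf_neq0 pq.
exists (p, q, j) => //; split.
  by split; rewrite //=; apply: mindexP => i; rewrite !cmM; case: (E i).
rewrite /= !mul1r => /eqP; rewrite intr_eq0; exact/negP.
Qed.

End Bracket.

(** By [cfC] the left and the right factors contributing to m form the same set, so one finite set
    serves both sums of [gbr]. *)
Definition bdom m : {fset bindex} :=
  fset_set [set p : bindex | exists q, cf p q m != 0]%classic.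

Lemma mem_bdom (R : realType) p q m :
  cf p q m != 0 -> (p \in bdom m) && (q \in bdom m).
Proof.
move=> nz; rewrite !in_fset_set; try exact: (finite_bdom R).
apply/andP; split; apply/mem_set => /=; first by exists q.
by exists p; rewrite cfC oppr_eq0.
Qed.

(* The Poisson bracket without its factor i, see [bracketE]. *)
Definition gbr (A : comNzRingType) (F G : bindex -> A) : bindex -> A := fun m =>
  \sum_(p <- bdom m) \sum_(q <- bdom m) F p * G q * (cf p q m)%:~R.

Definition vanish_below (A : comNzRingType) (n : nat) (F : bindex -> A) :=
  forall m, (bdeg m < n)%N -> F m = 0.

Section GenericBracket.
Context (R : realType) (A : comNzRingType).
Implicit Types (F G H : bindex -> A) (a : A).

Lemma gbrE (U V : {fset bindex}) F G m :
  (bdom m `<=` U)%fset -> (bdom m `<=` V)%fset ->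
  gbr F G m = \sum_(p <- U) \sum_(q <- V) F p * G q * (cf p q m)%:~R.
Proof.
have z p q : ~~ ((p \in bdom m) && (q \in bdom m)) ->
    F p * G q * (cf p q m)%:~R = 0.
  move=> h; have [->|/(mem_bdom R)] := eqVneq (cf p q m) 0; first by rewrite mulr0.
  by rewrite (negbTE h).
move=> mU mV; rewrite /gbr (big_fset_incl _ mU) /= => [|p _ pm]; last first.
  by rewrite big1// => q _; rewrite z// negb_and pm.
apply: eq_bigr => p _; apply: big_fset_incl => // q _ qm.
by rewrite z// negb_and qm orbT.
Qed.

Lemma eq_gbr F F' G G' m :
  (forall p q, cf p q m != 0 -> F p * G q = F' p * G' q) ->
  gbr F G m = gbr F' G' m.
Proof.
move=> E; apply: eq_bigr => p _; apply: eq_bigr => q _.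
by have [->|/E->//] := eqVneq (cf p q m) 0; rewrite !mulr0.
Qed.

Lemma gbr_eq0 F G m :
  (forall p q, cf p q m != 0 -> F p * G q = 0) -> gbr F G m = 0.
Proof.
move=> E; rewrite (@eq_gbr _ (fun=> 0) _ (fun=> 0)) => [|p q /E ->].
  by rewrite /gbr big1// => p _; rewrite big1// => q _; rewrite !mul0r.
by rewrite mul0r.
Qed.

Lemma gbrC F G : gbr F G = - gbr G F.
Proof.
apply/funext => m; rewrite !fctE /gbr exchange_big -sumrN /=.
apply: eq_bigr => p _; rewrite -sumrN; apply: eq_bigr => q _.
by rewrite cfC mulrNz mulrN [F q * _]mulrC.
Qed.

Lemma gbrDr F G G' : gbr F (G + G') = gbr F G + gbr F G'.
Proof.
apply/funext => m; rewrite !fctE /gbr -big_split /=.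
apply: eq_bigr => p _; rewrite -big_split /=; apply: eq_bigr => q _.
by rewrite mulrDr mulrDl.
Qed.

Lemma gbrZr a F G : gbr F (a \*o G) = a \*o gbr F G.
Proof.
apply/funext => m; rewrite /= /gbr mulr_sumr; apply: eq_bigr => p _.
by rewrite mulr_sumr; apply: eq_bigr => q _; rewrite mulrCA !mulrA.
Qed.

Lemma gbrZl a F G : gbr (a \*o F) G = a \*o gbr F G.
Proof.
rewrite gbrC gbrZr [gbr G F]gbrC; apply/funext => m.
by change (- (a * - gbr F G m) = a * gbr F G m); rewrite mulrN opprK.
Qed.

Lemma gbrNr F G : gbr F (- G) = - gbr F G.
Proof.
have -> : - G = (-1) \*o G by apply/funext => m; rewrite !fctE /= mulN1r.
by rewrite gbrZr; apply/funext => m; rewrite !fctE /= mulN1r.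
Qed.

Lemma gbrBr F G G' : gbr F (G - G') = gbr F G - gbr F G'.
Proof. by rewrite gbrDr gbrNr. Qed.

Lemma gbrBl F F' G : gbr (F - F') G = gbr F G - gbr F' G.
Proof. by rewrite gbrC gbrBr opprB [gbr G F]gbrC [gbr G F']gbrC opprK addrC. Qed.

Lemma gbr0r F : gbr F 0 = 0.
Proof. by rewrite -[X in gbr F X](subrr 0) gbrBr subrr. Qed.

Lemma gbr_sumr (n : nat) F (G : 'I_n -> bindex -> A) :
  gbr F (\sum_(i < n) G i) = \sum_(i < n) gbr F (G i).
Proof. exact: (big_morph (gbr F) (gbrDr F) (gbr0r F)). Qed.

Lemma gbr_vanish (a b : nat) F G m :
  vanish_below a F -> vanish_below b G -> (bdeg m + 2 < a + b)%N -> gbr F G m = 0.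
Proof.
move=> Fa Gb mab; apply: gbr_eq0 => p q /cf_bdeg E.
have [/Fa ->|pa] := ltnP (bdeg p) a; first by rewrite mul0r.
by rewrite Gb ?mulr0//; move: E mab pa; clear; lia.
Qed.

Lemma gbr_momentum F G m : momentum m <> 0 -> gbr F G m = 0.
Proof. by move=> m0; apply: gbr_eq0 => p q /cf_momentum. Qed.

(** Moving the sum over the intermediate monomial n innermost isolates an integer to which
    [cf_jacobi] applies. U has to contain two levels of factors: those of m and those of each n in
    [bdom m]. *)
Lemma gbr2E (U : {fset bindex}) F G H m :
  (bdom m `<=` U)%fset -> (forall n, n \in bdom m -> (bdom n `<=` U)%fset) ->
  gbr (gbr F G) H m = \sum_(r <- U) \sum_(p <- U) \sum_(q <- U)
    F p * G q * H r * (\sum_(n <- bdom m) cf p q n * cf n r m)%:~R.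
Proof.
move=> mU nU; rewrite (gbrE _ _ (fsubset_refl _) mU) exchange_big /=.
apply: eq_bigr => r _; transitivity (\sum_(n <- bdom m) \sum_(p <- U) \sum_(q <- U)
    F p * G q * H r * (cf p q n * cf n r m)%:~R).
  apply: eq_big_seq => n nm; rewrite (gbrE _ _ (nU n nm) (nU n nm)) !mulr_suml.
  apply: eq_bigr => p _; rewrite !mulr_suml; apply: eq_bigr => q _.
  by rewrite intrM; ring.
rewrite exchange_big /=; apply: eq_bigr => p _.
rewrite exchange_big /=; apply: eq_bigr => q _.
by rewrite -mulr_sumr rmorph_sum.
Qed.

Lemma gbr_jacobi F G H :
  gbr (gbr F G) H + gbr (gbr G H) F + gbr (gbr H F) G = 0.
Proof.
have sum3 (I : Type) (s : seq I) (f g h : I -> A) :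
    (forall i, f i + g i + h i = 0) ->
    \sum_(i <- s) f i + \sum_(i <- s) g i + \sum_(i <- s) h i = 0.
  by move=> fgh; rewrite -!big_split /= big1.
have cyc (x y z : A) (a b c : int) : a + b + c = 0 ->
    x * y * z * a%:~R + y * z * x * b%:~R + z * x * y * c%:~R = 0.
  move=> /(congr1 (fun n : int => n%:~R : A)); rewrite !intrD => abc.
  by rewrite -(mulr0 (x * y * z)) -[0 in RHS]abc; ring.
apply/funext => m; rewrite !fctE.
pose U := (bdom m `|` \bigcup_(n <- bdom m) bdom n)%fset.
have mU : (bdom m `<=` U)%fset by exact: fsubsetUl.
have nU n : n \in bdom m -> (bdom n `<=` U)%fset.
  move=> nm; apply: fsubset_trans (fsubsetUr _ _).
  by apply/fsubsetP => p pn; apply/bigfcupP; exists n; rewrite ?nm.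
have E1 := gbr2E F G H mU nU.
have E2 := gbr2E G H F mU nU.
have E3 := gbr2E H F G mU nU.
apply: (eq_trans (congr2 +%R (congr2 +%R E1 E2) E3)).
(* The summations are permuted so that F, G and H carry the same indices in all three terms. *)
rewrite [X in _ + X]exchange_big /=.
under [X in _ + X + _]eq_bigr do rewrite exchange_big /=.
rewrite [X in _ + X + _]exchange_big /=; apply: (sum3) => r.
rewrite [X in _ + X]exchange_big /=; apply: (sum3) => p; apply: (sum3) => q.
by apply: cyc; apply: cf_jacobi => n s /(mem_bdom R)/andP[].
Qed.

Lemma gbr_leibniz F G H :
  gbr F (gbr G H) = gbr (gbr F G) H + gbr G (gbr F H).
Proof.
have J := gbr_jacobi F G H.
rewrite [gbr F (gbr _ _)]gbrC [gbr G (gbr _ _)]gbrC [gbr F H]gbrC.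
have -> : gbr (- gbr H F) G = - gbr (gbr H F) G by rewrite gbrC gbrNr -gbrC.
by apply/eqP; rewrite opprK eq_sym -subr_eq0 opprK addrAC J.
Qed.

End GenericBracket.

(** * The quadratic Hamiltonian and its small divisors *)

Definition small_divisor (R : realType) (w : int -> R) m : R[i] :=
  \sum_(j <- bsupp m) ((w j)%:C)%C * ((m.1 j)%:Z - (m.2 j)%:Z)%:~R.

Section QuadraticPart.
Context (R : realType) (w : int -> R).

Lemma small_divisor_neq0 m : nonresonant w -> m.1 <> m.2 -> small_divisor w m != 0.
Proof.
move=> hw mm; pose l : {fsfun int -> int with 0} :=
  [fsfun j in bsupp m => (m.1 j)%:Z - (m.2 j)%:Z | 0].
have lE j : l j = (m.1 j)%:Z - (m.2 j)%:Z.
  by rewrite fsfunE; case: ifPn => // /bsuppP[-> ->]; rewrite subrr.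
have l0 : l <> [fsfun].
  move=> l0; apply: mm; apply: mindexP => j; move: (lE j).
  by rewrite l0 fsfunE => /esym/eqP; rewrite subr_eq0 => /eqP[].
have -> : small_divisor w m = ((wdot w l)%:C)%C.
  rewrite /wdot rmorph_sum /= /small_divisor.
  have sl : (finsupp l `<=` bsupp m)%fset.
    apply/fsubsetP => j; rewrite mem_finsupp lE; apply: contraR => /bsuppP[-> ->].
    by rewrite subrr.
  rewrite [RHS](big_fset_incl _ sl) => [|j _]; last first.
    by rewrite memNfinsupp => /eqP ->; rewrite mulr0.
  by apply: eq_bigr => j _; rewrite rmorphM /= rmorph_int lE.
have /eqP := hw _ l0; apply: contra => /eqP E.
by apply/eqP; case: E.
Qed.

(** The e_j gained by multiplying with |u_j|^2 is the one that the bracket removes, so the only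
    partner of |u_j|^2 producing m is m itself. *)
Lemma cf_bunit p j m : momentum m = 0 -> j \in bsupp m ->
  cf p (bunit j) m = ((m.1 j)%:Z - (m.2 j)%:Z) *+ (p == m).
Proof.
move=> m0 jm; have [->|pm] := eqVneq p m.
  rewrite (cfE _ (fsubset_refl _)) ?momentum_bunit// (big_fsetD1 j)//= big1_seq.
    by rewrite eqxx mulr1n addr0 /wedge /= cmUU !mulr1.
  move=> k; rewrite !inE => /andP[_ /andP[/negbTE kj _]].
  by rewrite /wedge /= cmU eq_sym kj !mulr0 subrr mul0rn.
apply/eqP/negP => /negP/cf_neq0[_ _ [k]]; rewrite /wedge /= cmU.
have [->|] := eqVneq j k; last by rewrite !mulr0 subrr eqxx.
by move=> _ /eqP; rewrite badd_eqr (negbTE pm).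
Qed.

Lemma cf_bunit_eq0 p j m : j \notin bsupp m -> cf p (bunit j) m = 0.
Proof.
move=> jm; apply/eqP/negP => /negP/cf_neq0[_ _ [k]]; rewrite /wedge /= cmU.
have [<-|] := eqVneq j k; last by rewrite !mulr0 subrr eqxx.
rewrite !mulr1 subr_eq0 => nz /eqP; rewrite badd_eqr => /eqP E.
by case/bsuppP: jm nz; rewrite E => -> ->; rewrite eqxx.
Qed.

Lemma bunit_inj : injective bunit.
Proof.
move=> j k /eqP; rewrite xpair_eqE andbb => /eqP/(congr1 (fun a : mindex => a j)).
by rewrite cmUU cmU; case: eqVneq.
Qed.

Context (A : comNzRingType) (iota : {rmorphism R[i] -> A}).

(** Monomials of zero momentum are eigenvectors of the bracket with D_w. As [gbr] leaves out the
    factor i, the eigenvalue is omega . (alpha - beta); inverting it off the diagonal solves the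
    homological equation. *)
Lemma gbr_quad (F : bindex -> A) m : momentum m = 0 ->
  gbr F (iota \o quad_ham w) m = F m * iota (small_divisor w m).
Proof.
move=> m0; pose U := (m |` bdom m)%fset.
pose V := ([fset bunit j | j in bsupp m] `|` bdom m)%fset.
rewrite (@gbrE R A U V) ?fsubsetUr//.
have mU : m \in U by rewrite !inE eqxx.
have vV : ([fset bunit j | j in bsupp m] `<=` V)%fset by exact: fsubsetUl.
rewrite exchange_big /= -(big_fset_incl _ vV) /=; last first.
  move=> q _ nq; apply: big1 => p _.
  have [[j Ej]|nj] := pselect (exists j, q = bunit j).
    rewrite Ej cf_bunit_eq0 ?mulr0//; apply: contra nq => jm.
    by rewrite Ej; apply/imfsetP; exists j.
  rewrite quad_ham_eq0 ?rmorph0 ?mulr0 ?mul0r// => j Ej.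
  by apply: nj; exists j.
rewrite big_imfset /=; last by move=> j k _ _ /bunit_inj.
rewrite /small_divisor rmorph_sum mulr_sumr; apply: eq_big_seq => j jm /=.
rewrite (big_fsetD1 m)//= big1_seq => [|p].
  by rewrite addr0 quad_hamE cf_bunit// eqxx rmorphM /= rmorph_int mulrA.
rewrite in_fsetD1 => /andP[_ /andP[/negbTE pm _]].
by rewrite cf_bunit// pm mulr0n mulr0.
Qed.

End QuadraticPart.

(** * Formal exponentials *)

Section FormalExponential.
Context (R : realType) (A : comNzRingType) (iota : {rmorphism R[i] -> A}).
Implicit Types (F G H : bindex -> A).

(** A is only a commutative ring, so 1/k! is formed in C and carried over by [iota]. *)
Definition eterm (k : nat) G H : bindex -> A :=
  iota (k`!%:R^-1) \*o iter k (gbr G) H.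

(* Every term of index [k > bdeg m] vanishes at m as soon as G has no monomial
   of degree less than 3. *)
Definition gexp G H : bindex -> A := fun m =>
  \sum_(k < (bdeg m).+1) eterm k G H m.

Lemma eterm0 G H : eterm 0 G H = H.
Proof.
by apply/funext => m; rewrite /eterm /= fact0 invr1 rmorph1 mul1r.
Qed.

Lemma etermS (k : nat) G H : k.+1%:R \*o eterm k.+1 G H = gbr G (eterm k G H).
Proof.
rewrite gbrZr; apply/funext => m /=; rewrite mulrA; congr (_ * _).
rewrite -(rmorph_nat iota) -rmorphM factS natrM invfM mulrA mulfV ?mul1r//.
by rewrite pnatr_eq0.
Qed.

Lemma iter_gbr_vanish (k : nat) G H : vanish_below 3 G -> vanish_below 2 H ->
  vanish_below (k + 2) (iter k (gbr G) H).
Proof.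
move=> G3 H2; elim: k => [|k IH] //= m mk.
by apply: (gbr_vanish G3 IH); move: mk; clear; lia.
Qed.

Lemma eterm_vanish (k : nat) G H : vanish_below 3 G -> vanish_below 2 H ->
  vanish_below (k + 2) (eterm k G H).
Proof.
by move=> G3 H2 m mk; rewrite /eterm /= iter_gbr_vanish// mulr0.
Qed.

Lemma gexpE (N : nat) G H m : vanish_below 3 G -> vanish_below 2 H ->
  (bdeg m < N)%N -> gexp G H m = \sum_(k < N) eterm k G H m.
Proof.
move=> G3 H2 mN; rewrite /gexp (big_ord_widen _ (fun k => eterm k G H m) mN).
rewrite big_mkcond; apply: eq_bigr => k _; case: ifPn => //; rewrite -leqNgt => mk.
by rewrite eterm_vanish//; move: mk; clear; lia.
Qed.

Lemma iter_gbr_momentum (k : nat) G H m :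
  (forall m', momentum m' <> 0 -> H m' = 0) ->
  momentum m <> 0 -> iter k (gbr G) H m = 0.
Proof. by move=> H0 m0; case: k => [|k] /=; [exact: H0|exact: gbr_momentum]. Qed.

Lemma gexp_momentum G H m : (forall m', momentum m' <> 0 -> H m' = 0) ->
  momentum m <> 0 -> gexp G H m = 0.
Proof.
by move=> H0 m0; apply: big1 => k _; rewrite /eterm /= iter_gbr_momentum// mulr0.
Qed.

(** Each bracket with G raises the degree by at least d and H starts in degree 2, so the terms with
    k >= 1 start in degree d + 2. *)
Lemma gexp_sub_vanish (d : nat) G H m :
  (1 <= d)%N -> vanish_below (d + 2) G -> vanish_below 2 H ->
  (bdeg m < d + 2)%N -> gexp G H m = H m.
Proof.
move=> d1 Gd H2 md; have G3 : vanish_below 3 G.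
  by move=> m' m'3; apply: Gd; move: m'3 d1; clear; lia.
rewrite /gexp big_ord_recl eterm0 big1 ?addr0// => k _.
rewrite /eterm /=; have V := iter_gbr_vanish (k := k) G3 H2.
by rewrite (gbr_vanish Gd V) ?mulr0//; move: md; clear; lia.
Qed.

(** The difference telescopes into {G - G', X} + {G', X - X'}. The first bracket may leave the
    difference in degree n, because H starts in degree 2; each further one raises the degree by at
    least 1. *)
Lemma iter_gbr_diff (n k : nat) G G' H :
  vanish_below 3 G -> vanish_below 3 G' -> vanish_below 2 H ->
  vanish_below n (G - G') ->
  vanish_below (n + k) (iter k.+1 (gbr G) H - iter k.+1 (gbr G') H).
Proof.
move=> G3 G'3 H2 GG'; have split X X' : gbr G X - gbr G' X' =
    gbr (G - G') X + gbr G' (X - X').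
  by rewrite gbrBl gbrBr addrA subrK.
elim: k => [|k IH] m mk.
  by rewrite /= -gbrBl (gbr_vanish GG' H2)//; move: mk; clear; lia.
rewrite iterS [in X in _ - X]iterS split !fctE.
rewrite (gbr_vanish GG' (iter_gbr_vanish (k := k.+1) G3 H2)); last first.
  by move: mk; clear; lia.
rewrite add0r (gbr_vanish G'3 IH)//; move: mk; clear; lia.
Qed.

(** In the lowest degree where G and G' may differ, the terms with k >= 2 agree by [iter_gbr_diff],
    and the term k = 1 sees the difference only through the quadratic part D_w of H. *)
Lemma gexp_diff (w : int -> R) G G' H m :
  vanish_below 3 G -> vanish_below 3 G' -> vanish_below 2 H ->
  (forall m', bdeg m' = 2%N -> H m' = iota (quad_ham w m')) ->
  vanish_below (bdeg m) (G - G') -> momentum m = 0 ->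
  gexp G H m - gexp G' H m = (G m - G' m) * iota (small_divisor w m).
Proof.
move=> G3 G'3 H2 Hq GG' m0.
have Hgbr : gbr G H m - gbr G' H m = (G m - G' m) * iota (small_divisor w m).
  rewrite -[LHS]/((gbr G H - gbr G' H) m) -gbrBl -[RHS](gbr_quad w iota (G - G') m0).
  apply: eq_gbr => p q /cf_bdeg E /=.
  (* Since bdeg p + bdeg q = bdeg m + 2, a nonzero first factor forces bdeg q <= 2. *)
  have [pm|pm] := ltnP (bdeg p) (bdeg m); first by rewrite GG'// !mul0r.
  have [q2|q2] := ltnP (bdeg q) 2; last by rewrite Hq//; move: E pm q2; clear; lia.
  rewrite H2// quad_ham_eq0 ?rmorph0// => j qj.
  by move: q2; rewrite qj bdeg_bunit.
(* The bound [(bdeg m).+2] allows the terms k = 0 and k = 1 to be split off even in degree 0. *)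
rewrite (gexpE (N := (bdeg m).+2) G3 H2)// (gexpE (N := (bdeg m).+2) G'3 H2)//.
rewrite -sumrB !big_ord_recl big1 => [|k _]; last first.
  rewrite /eterm /= -mulrBr.
  have D : vanish_below (bdeg m + k.+1) _ := iter_gbr_diff G3 G'3 H2 GG'.
  by rewrite -[X in _ * X]/((iter k.+2 (gbr G) H - iter k.+2 (gbr G') H) m) D
    ?mulr0//; lia.
have e1 X : eterm 1 X H m = gbr X H m by rewrite /eterm /= invr1 rmorph1 mul1r.
by rewrite addr0 !eterm0 subrr add0r !e1.
Qed.

End FormalExponential.

Definition offdiag_zero (A : comNzRingType) (F : bindex -> A) :=
  forall m, m.1 <> m.2 -> F m = 0.

(** * Generators with a prescribed diagonal part *)

Section NormalForm.
Context (R : realType) (w : int -> R) (hw : nonresonant w).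
Context (A : comNzRingType) (iota : {rmorphism R[i] -> A}) (H : bindex -> A).
Hypothesis H_low : vanish_below 2 H.
Hypothesis H_quad : forall m, bdeg m = 2%N -> H m = iota (quad_ham w m).
Hypothesis H_mom : forall m, momentum m <> 0 -> H m = 0.
Implicit Types (G : bindex -> A).

Lemma small_divisorK m : m.1 <> m.2 ->
  iota (small_divisor w m) * iota (small_divisor w m)^-1 = 1.
Proof. by move=> mm; rewrite -rmorphM mulfV ?rmorph1// small_divisor_neq0. Qed.

(** Induction on the degree: if G and G' agree below the degree of an off-diagonal m, then by
    [gexp_diff] the product of G m - G' m with an invertible small divisor is 0. *)
Lemma gexp_offdiag_uniq G G' :
  vanish_below 3 G -> vanish_below 3 G' ->
  (forall m, momentum m <> 0 -> G m = 0) ->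
  (forall m, momentum m <> 0 -> G' m = 0) ->
  (forall m, m.1 = m.2 -> G m = G' m) ->
  offdiag_zero (gexp iota G H) -> offdiag_zero (gexp iota G' H) -> G = G'.
Proof.
move=> G3 G'3 Gm G'm GG' GH G'H.
have D k : vanish_below k (G - G').
  elim: k => [//|k IH] m; rewrite ltnS => mk; rewrite !fctE.
  have [/GG' ->|/eqP mm] := eqVneq m.1 m.2; first by rewrite subrr.
  have [m0|/eqP m0] := eqVneq (momentum m) 0; last by rewrite Gm// G'm// subrr.
  have GGm : vanish_below (bdeg m) (G - G').
    by move=> m' m'm; apply: IH; apply: leq_trans mk.
  have := gexp_diff G3 G'3 H_low H_quad GGm m0.
  rewrite GH// G'H// subrr => /(congr1 ( *%R^~ (iota (small_divisor w m)^-1))).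
  by rewrite mul0r -mulrA small_divisorK// mulr1.
apply/funext => m; apply/eqP; rewrite -subr_eq0; apply/eqP.
exact: (D (bdeg m).+1 m).
Qed.

Context (d : nat) (Q : bindex -> A).
Hypothesis d_gt0 : (1 <= d)%N.
Hypothesis H_diag : forall m, (bdeg m < d + 2)%N -> m.1 <> m.2 -> H m = 0.

(* A fixed point of [nf_step] is a generator with diagonal part Q whose
   exponential kills the off-diagonal part of H; the component of degree n of
   [nf_step G] only depends on the components of G of degree less than n. *)
Definition nf_step G : bindex -> A := fun m =>
  if (bdeg m < d + 2)%N then 0 else
  if m.1 == m.2 then Q m else
  if momentum m != 0 then 0 else G m - gexp iota G H m * iota (small_divisor w m)^-1.

Lemma nf_step_vanish G : vanish_below (d + 2) (nf_step G).
Proof. by move=> m; rewrite /nf_step => ->. Qed.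

(** By [gexp_diff], the change of e^G H at m divided by the small divisor is exactly the change of G
    at m, and the subtraction in [nf_step] cancels it. *)
Lemma nf_step_agree G G' m : vanish_below 3 G -> vanish_below 3 G' ->
  vanish_below (bdeg m) (G - G') -> nf_step G m = nf_step G' m.
Proof.
move=> G3 G'3 GG'; rewrite /nf_step; case: ifP => // _.
case: eqP => // mm; case: eqP => //= m0.
apply/eqP; rewrite -subr_eq0 opprD addrACA -opprD -mulrBl.
rewrite (gexp_diff G3 G'3 H_low H_quad GG' m0).
by rewrite -mulrA small_divisorK// mulr1 subrr.
Qed.

(** Each application of [nf_step] makes one more degree final, so the coefficient at m has its
    definitive value after bdeg m + 1 steps. *)
Definition nf_gen : bindex -> A := fun m => iter (bdeg m).+1 nf_step 0 m.

Lemma vanish_lt3 G : vanish_below (d + 2) G -> vanish_below 3 G.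
Proof. by move=> Gd m m3; apply: Gd; move: d_gt0 m3; clear; lia. Qed.

Lemma iter_nf_step_vanish (k : nat) : vanish_below (d + 2) (iter k nf_step 0).
Proof. by case: k => [//|k]; exact: nf_step_vanish. Qed.

Lemma nf_gen_vanish : vanish_below (d + 2) nf_gen.
Proof. by move=> m; exact: iter_nf_step_vanish. Qed.

Lemma iter_nf_step_stable (k : nat) m :
  (bdeg m < k)%N -> iter k nf_step 0 m = nf_gen m.
Proof.
have S j m' : (bdeg m' < j)%N -> iter j.+1 nf_step 0 m' = iter j nf_step 0 m'.
  elim: j m' => [//|j IH] m' m'j.
  change (nf_step (iter j.+1 nf_step 0) m' = nf_step (iter j nf_step 0) m').
  apply: nf_step_agree; try exact: vanish_lt3 (iter_nf_step_vanish _).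
  move=> m'' m''m'; rewrite !fctE IH ?subrr//.
  by apply: leq_trans m''m' _; rewrite -ltnS.
elim: k => [//|k IH]; rewrite ltnS leq_eqVlt => /orP[/eqP <- //|mk].
by rewrite S// IH.
Qed.

Lemma nf_gen_fix m : nf_step nf_gen m = nf_gen m.
Proof.
change (nf_step nf_gen m = nf_step (iter (bdeg m) nf_step 0) m).
apply: nf_step_agree.
- exact: vanish_lt3 nf_gen_vanish.
- exact: vanish_lt3 (iter_nf_step_vanish _).
by move=> m' m'm; rewrite !fctE iter_nf_step_stable// subrr.
Qed.

Lemma nf_gen_diag m : (d + 2 <= bdeg m)%N -> m.1 = m.2 -> nf_gen m = Q m.
Proof. by move=> md mm; rewrite -nf_gen_fix /nf_step ltnNge md mm eqxx. Qed.

Lemma nf_gen_momentum m : momentum m <> 0 -> nf_gen m = 0.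
Proof.
move=> /eqP m0; rewrite -nf_gen_fix /nf_step m0; case: ifP => // _.
case: eqP => // mm; case/eqP: m0; rewrite /momentum big1// => j _.
by rewrite mm subrr mulr0.
Qed.

(** Below degree d + 2 the exponential leaves H unchanged, and H is diagonal there. From that degree
    on, the fixed point equation says that the coefficient of e^G H divided by the small divisor is
    0. *)
Lemma nf_gen_offdiag : offdiag_zero (gexp iota nf_gen H).
Proof.
move=> m mm; have [md|md] := ltnP (bdeg m) (d + 2).
  by rewrite (gexp_sub_vanish iota d_gt0 nf_gen_vanish H_low md) H_diag.
have [m0|/eqP m0] := eqVneq (momentum m) 0; last exact: gexp_momentum.
have := nf_gen_fix m; rewrite {1}/nf_step ltnNge md m0 eqxx /=.
case: eqP => // _ /eqP; rewrite -subr_eq0 addrAC subrr add0r oppr_eq0.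
move=> /eqP/(congr1 ( *%R^~ (iota (small_divisor w m)))).
by rewrite mul0r -mulrA [X in _ * X]mulrC small_divisorK// mulr1.
Qed.

End NormalForm.

(** Applied to evaluations C[t] -> C, this specialises the formal parameter t. *)
Lemma gexp_morph (R : realType) (A B : comNzRingType)
    (iota : {rmorphism R[i] -> A}) (iota' : {rmorphism R[i] -> B})
    (f : {rmorphism A -> B}) (G H : bindex -> A) :
  f \o iota =1 iota' -> f \o gexp iota G H = gexp iota' (f \o G) (f \o H).
Proof.
move=> fE; have fbr F F' : f \o gbr F F' = gbr (f \o F) (f \o F').
  apply/funext => m /=; rewrite rmorph_sum; apply: eq_bigr => p _.
  by rewrite rmorph_sum; apply: eq_bigr => q _; rewrite !rmorphM /= rmorph_int.
apply/funext => m /=; rewrite rmorph_sum; apply: eq_bigr => k _.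
rewrite /eterm /= rmorphM /= -fE /=; congr (_ * _).
rewrite -[LHS]/((f \o iter k (gbr G) H) m); congr (_ m).
by elim: (k : nat) => [//|j IH]; rewrite !iterS fbr IH.
Qed.

(** * Duhamel's formula and uniqueness of the normal form *)

Section Duhamel.
Context (R : realType).
Local Notation A := {poly R[i]}.
Local Notation iota := (polyC : {rmorphism R[i] -> A}).
Implicit Types (F G H : bindex -> A).

Definition derivs F : bindex -> A := fun m => (F m)^`().

Lemma derivs_gbr F G : derivs (gbr F G) = gbr (derivs F) G + gbr F (derivs G).
Proof.
apply/funext => m; rewrite !fctE /derivs /gbr -big_split raddf_sum /=.
apply: eq_bigr => p _; rewrite -big_split raddf_sum /=; apply: eq_bigr => q _.
by rewrite !derivM -(rmorph_int iota) derivC mulr0 addr0 mulrDl.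
Qed.

Lemma derivs_scale (n : nat) F : derivs (n%:R \*o F) = n%:R \*o derivs F.
Proof.
by apply/funext => m; rewrite /derivs /= !mulr_natl derivMn.
Qed.

Lemma derivs_const (H : bindex -> R[i]) : derivs (iota \o H) = 0.
Proof. by apply/funext => m; rewrite /derivs /= derivC. Qed.

(** Both sides run over the pairs with i + j < N; the left one groups them by i + j = n - 1. *)
Lemma sum_triangle (N : nat) (f : nat -> nat -> A) :
  \sum_(n < N.+1) \sum_(i < n) f i (n.-1 - i)%N =
  \sum_(i < N) \sum_(j < N - i) f i j.
Proof.
elim: N => [|N IH]; first by rewrite big_ord_recl !big_ord0 addr0.
rewrite big_ord_recr IH /= [RHS]big_ord_recr /= subSnn big_ord1.
rewrite [X in _ + X]big_ord_recr /= subnn addrA -big_split /=; congr (_ + _).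
by apply: eq_bigr => i _; rewrite subSn ?[in RHS]big_ord_recr// ltnW.
Qed.

(** The term b i gets weight i + 1 from the shifted family and n - i from the other one, in total n
    + 1. *)
Lemma sum_weights (n : nat) (b : nat -> A) :
  b 0%N + \sum_(i < n) (i.+2%:R * b i.+1 + (n - i)%:R * b i) =
  n.+1%:R * \sum_(i < n.+1) b i.
Proof.
rewrite big_split /= addrA.
have -> : b 0%N + \sum_(i < n) i.+2%:R * b i.+1 = \sum_(i < n.+1) i.+1%:R * b i.
  by rewrite big_ord_recl mul1r.
have -> : \sum_(i < n) (n - i)%:R * b i = \sum_(i < n.+1) (n - i)%:R * b i.
  by rewrite big_ord_recr /= subnn mul0r addr0.
rewrite -big_split mulr_sumr; apply: eq_bigr => i _ /=.
by rewrite -mulrDl -natrD addSn subnKC// -ltnS.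
Qed.

Context (G H : bindex -> A).
Hypothesis H_const : derivs H = 0.

Local Notation E k := (eterm iota k G H).

(* The derivative of [e^G H] is the bracket of [\sum_i duhamel i] with
   [e^G H]. *)
Definition duhamel (i : nat) : bindex -> A :=
  iota (i.+1`!%:R^-1) \*o iter i (gbr G) (derivs G).

Lemma duhamelS (i : nat) : i.+2%:R \*o duhamel i.+1 = gbr G (duhamel i).
Proof.
rewrite gbrZr; apply/funext => m /=; rewrite mulrA; congr (_ * _).
rewrite -(rmorph_nat iota) -rmorphM [i.+2`!]factS natrM invfM mulrA mulfV ?mul1r//.
by rewrite pnatr_eq0.
Qed.

Lemma duhamel0 : duhamel 0 = derivs G.
Proof. by apply/funext => m; rewrite /duhamel /= invr1 rmorph1 mul1r. Qed.

Lemma natr_scale_inj (n : nat) F F' : n.+1%:R \*o F = n.+1%:R \*o F' -> F = F'.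
Proof.
move=> FF'; apply/funext => m.
have n0 : n.+1%:R != 0 :> A by rewrite -(rmorph_nat iota) polyC_eq0 pnatr_eq0.
by apply: (mulfI n0); rewrite -[LHS]/((n.+1%:R \*o F) m) FF'.
Qed.

(** This is the part of Duhamel's formula with n factors G. In the induction, (n + 1) E_{n+1} = {G,
    E_n} is differentiated, Leibniz' rule distributes the outer G, and [sum_weights] yields the
    common factor n + 1, which is then cancelled. *)
Lemma derivs_eterm (n : nat) :
  derivs (E n) = \sum_(i < n) gbr (duhamel i) (E (n.-1 - i)%N).
Proof.
elim: n => [|n IH]; first by rewrite eterm0 big_ord0.
have step (i : 'I_n) : gbr G (gbr (duhamel i) (E (n.-1 - i)%N)) =
    i.+2%:R \*o gbr (duhamel i.+1) (E (n - i.+1)%N)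
    + (n - i)%:R \*o gbr (duhamel i) (E (n - i)%N).
  rewrite (gbr_leibniz R) -duhamelS gbrZl -etermS gbrZr.
  have -> : (n.-1 - i = n - i.+1)%N by lia.
  by rewrite -subSn// subSS.
apply: (@natr_scale_inj n); rewrite -derivs_scale etermS derivs_gbr IH gbr_sumr.
under eq_bigr do rewrite step.
apply/funext => m; rewrite /= !fctE !fct_sumE -duhamel0.
have := sum_weights n (fun i => gbr (duhamel i) (E (n - i)%N) m).
by rewrite subn0 => <-.
Qed.

(* Bracketing with the diagonal series [gexp iota G H] kills every diagonal
   coefficient, by [cf_diag]. *)
Lemma derivs_gexp_diag m : vanish_below 3 G -> vanish_below 2 H ->
  offdiag_zero (gexp iota G H) -> m.1 = m.2 -> (gexp iota G H m)^`() = 0.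
Proof.
move=> G3 H2 K0 mm.
have W_low i : vanish_below (i + 3) (duhamel i).
  move=> m' m'i; rewrite /duhamel /=; suff -> : iter i (gbr G) (derivs G) m' = 0.
    by rewrite mulr0.
  elim: i m' m'i => [|i IH] m' m'i; first by rewrite /= /derivs G3 ?deriv0.
  by apply: (gbr_vanish G3 IH); move: m'i; clear; lia.
rewrite /gexp raddf_sum /=.
have -> : \sum_(n < (bdeg m).+1) (E n m)^`() =
    \sum_(n < (bdeg m).+1) \sum_(i < n) gbr (duhamel i) (E (n.-1 - i)%N) m.
  apply: eq_bigr => n _; rewrite -[LHS]/(derivs (E n) m) derivs_eterm.
  by rewrite fct_sumE.
rewrite (sum_triangle (bdeg m) (fun i j => gbr (duhamel i) (E j) m)).
apply: big1 => i _; have -> : \sum_(j < bdeg m - i) gbr (duhamel i) (E j) m =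
    gbr (duhamel i) (\sum_(j < bdeg m - i) E j) m by rewrite gbr_sumr fct_sumE.
apply: gbr_eq0 => p q nz; have pq := cf_bdeg nz.
have [pi|pi] := ltnP (bdeg p) (i + 3); first by rewrite W_low// mul0r.
(* Here bdeg q < bdeg m - i, so the truncated sum at q is already the whole exponential. *)
rewrite fct_sumE -gexpE//; last by move: pq pi (ltn_ord i); clear; lia.
have [qq|qq] := pselect (q.1 = q.2); last by rewrite K0// mulr0.
by move: nz; rewrite cf_diag// eqxx.
Qed.

Lemma gexp_const m : vanish_below 3 G -> vanish_below 2 H ->
  offdiag_zero (gexp iota G H) -> (gexp iota G H m)^`() = 0.
Proof.
move=> G3 H2 K0; have [mm|mm] := pselect (m.1 = m.2); last by rewrite K0// deriv0.
exact: derivs_gexp_diag.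
Qed.

End Duhamel.

Section Uniqueness.
Context (R : realType) (w : int -> R) (hw : nonresonant w).
Local Notation C := R[i].
Local Notation iota := (polyC : {rmorphism C -> {poly C}}).
Local Notation id := (idfun : {rmorphism C -> C}).
Context (H : bindex -> C).
Hypothesis H_low : vanish_below 2 H.
Hypothesis H_quad : forall m, bdeg m = 2%N -> H m = quad_ham w m.
Hypothesis H_mom : forall m, momentum m <> 0 -> H m = 0.
Hypothesis H_diag : forall m, (bdeg m < 3)%N -> m.1 <> m.2 -> H m = 0.

Lemma deriv_eq0 (p : {poly C}) (a b : C) : p^`() = 0 -> p.[a] = p.[b].
Proof.
move=> p0; suff -> : p = (p`_0)%:P by rewrite !hornerC.
apply/polyP => -[|i]; rewrite coefC //=; apply/eqP.
have /eqP : p^`()`_i = 0 by rewrite p0 coef0.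
by rewrite coef_deriv -mulr_natr mulf_eq0 pnatr_eq0 orbF.
Qed.

Lemma gexp_uniq S G : vanish_below 3 S -> vanish_below 3 G ->
  (forall m, momentum m <> 0 -> S m = 0) ->
  (forall m, momentum m <> 0 -> G m = 0) ->
  offdiag_zero (gexp id S H) -> offdiag_zero (gexp id G H) ->
  gexp id S H = gexp id G H.
Proof.
move=> S3 G3 Sm Gm SH GH.
pose Hp : bindex -> {poly C} := iota \o H.
have Hp_low : vanish_below 2 Hp by move=> m m2; rewrite /Hp /= H_low// rmorph0.
have Hp_quad m : bdeg m = 2%N -> Hp m = iota (quad_ham w m).
  by move=> m2; rewrite /Hp /= H_quad.
have Hp_mom m : momentum m <> 0 -> Hp m = 0.
  by move=> m0; rewrite /Hp /= H_mom// rmorph0.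
have Hp_diag m : (bdeg m < 1 + 2)%N -> m.1 <> m.2 -> Hp m = 0.
  by move=> m3 mm; rewrite /Hp /= H_diag// rmorph0.
(* Q interpolates linearly from S at t = 0 to G at t = 1. From degree 3 on, T takes its diagonal
   coefficients from Q and solves for the others. *)
pose Q m : {poly C} := (S m)%:P + (G m - S m)%:P * 'X.
pose T := nf_gen w iota Hp 1 Q.
have T3 : vanish_below (1 + 2) T by exact: nf_gen_vanish.
have TH : offdiag_zero (gexp iota T Hp) by exact: nf_gen_offdiag.
have evH (a : C) : horner_eval a \o Hp = H.
  by apply/funext => m; rewrite /Hp /= /horner_eval hornerC.
have evK (a : C) : horner_eval a \o gexp iota T Hp = gexp id (horner_eval a \o T) H.
  rewrite -[in RHS](evH a); apply: gexp_morph => c.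
  by rewrite /= /horner_eval hornerC.
(* At t = a the series T has the diagonal part of X and still removes the off-diagonal part of H, so
   [gexp_offdiag_uniq] identifies it with X. *)
have evT (a : C) X : vanish_below 3 X -> (forall m, momentum m <> 0 -> X m = 0) ->
    (forall m, (Q m).[a] = X m) -> offdiag_zero (gexp id X H) ->
    horner_eval a \o T = X.
  move=> X3 Xm QX XH; apply: (gexp_offdiag_uniq (iota := id) hw H_low) => //.
  - by move=> m m3; rewrite /= T3// rmorph0.
  - by move=> m m0; rewrite /= /T nf_gen_momentum// rmorph0.
  - move=> m mm; have [m3|m3] := ltnP (bdeg m) 3.
      by rewrite /= T3// rmorph0 X3.
    by rewrite /= /T nf_gen_diag// -QX.
  - by move=> m mm; rewrite -evK /= TH// rmorph0.
have T0 : horner_eval 0 \o T = S.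
  by apply: evT => // m; rewrite /Q hornerD hornerMX hornerC mulr0 addr0.
have T1 : horner_eval 1 \o T = G.
  by apply: evT => // m; rewrite /Q hornerD hornerMX !hornerC mulr1 addrC subrK.
(* Both sides are now values, at 0 and at 1, of polynomials with zero derivative. *)
rewrite -T0 -T1 -!evK; apply/funext => m /=; apply: deriv_eq0.
by apply: gexp_const => //; exact: derivs_const.
Qed.

End Uniqueness.

(** * Formal Hamiltonians *)

Section Bridge.
Context (R : realType).
Local Notation id := (idfun : {rmorphism R[i] -> R[i]}).
Implicit Types (F G H S : series R).

(** Given p, q and m, the relation determines j, so a single term of the sum survives. *)
Lemma cf_wedge p q m j : momentum p = 0 -> momentum q = 0 ->
  badd p q = badd m (bunit j) -> cf p q m = wedge p q j.
Proof.
move=> p0 q0 E; rewrite (@cfE (j |` bsupp p)%fset) ?fsubsetUr// E.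
rewrite (big_fsetD1 j) ?fset1U1//= eqxx mulr1n big1_seq ?addr0// => k.
rewrite in_fsetD1 => /andP[_ /andP[kj _]].
rewrite [badd m _]baddC [badd m _]baddC badd_eqr.
by case: eqP => [/bunit_inj jk|//]; rewrite jk eqxx in kj.
Qed.

(** The factor i is absorbed into the first argument, so that iterated brackets with S become
    iterates of [gbr] with i S. *)
Lemma bracketE F G : bracket F G = gbr ('i \*o F) G.
Proof.
rewrite gbrZl; apply/funext => m; rewrite /bracket /=; congr (_ * _).
pose f (t : bindex * bindex * int) := F t.1.1 * G t.1.2 * (bracket_factor t)%:~R.
pose g t := if t \in bracket_support m then f t else 0.
pose U := bdom m; pose J := (\bigcup_(p <- U) bsupp p)%fset.
(* B is a finite box holding every triple of the support with nonzero [bracket_factor]. *)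
pose B := (([set` U] `*` [set` U]) `*` [set` J])%classic.
have pJ p : p \in U -> (bsupp p `<=` J)%fset.
  by move=> pU; apply/fsubsetP => j jp; apply/bigfcupP; exists p; rewrite ?pU.
have suppP p q j : reflect [/\ momentum p = 0, momentum q = 0 &
    badd p q = badd m (bunit j)] ((p, q, j) \in bracket_support m).
  apply: (iffP idP) => [/set_mem[/= p0 q0 E1 E2]|[p0 q0 [E1 E2]]].
    by split => //; congr pair.
  by apply/mem_set.
transitivity (\sum_(t \in B) g t)%R.
  rewrite -fsbig_mkcondr; apply/esym/fsbig_widen; first by move=> t [].
  move=> [[p q] j] [/= St nB]; have [p0 q0 E] := elimT (suppP p q j) (mem_set St).
  rewrite /f /=; have [->|nz] := eqVneq (bracket_factor (p, q, j)) 0.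
    by rewrite mulr0.
  have wj : cf p q m != 0 by rewrite (cf_wedge p0 q0 E).
  case: nB; split => //; have /andP[pU qU] := mem_bdom R wj; split => //=.
  apply: (fsubsetP (pJ p pU)); apply: contraR nz => jp.
  by apply/eqP; exact: (wedge_bsuppl q jp).
transitivity (\sum_(p <- U) \sum_(q <- U) \sum_(j <- J) g (p, q, j)).
  apply/esym; transitivity (\sum_(t \in [set` U] `*` [set` U])
      \sum_(j \in [set` J]) g (t, j))%R.
    rewrite fsbig_seq ?fset_uniq//.
    under eq_fsbigr do rewrite fsbig_seq ?fset_uniq//.
    rewrite pair_fsbig ?finite_fset//; apply: eq_fsbigr => -[p q] _ /=.
    by rewrite fsbig_seq ?fset_uniq.
  by rewrite pair_fsbig ?finite_fset//; exact: finite_setX.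
apply: eq_big_seq => p pU; apply: eq_bigr => q _.
have [/andP[/eqP p0 /eqP q0]|pq0] :=
    boolP ((momentum p == 0) && (momentum q == 0)).
  rewrite (cfE _ (pJ p pU) p0 q0) rmorph_sum mulr_sumr; apply: eq_bigr => j _ /=.
  rewrite /g; case: suppP => [[_ _ ->]|nE]; first by rewrite eqxx.
  by case: eqP => [E|_]; [case: nE|rewrite mulr0n mulr0].
rewrite /cf (negbTE pq0) mulr0; apply: big1 => j _; rewrite /g.
by case: suppP => // -[p0 q0]; rewrite p0 q0 eqxx in pq0.
Qed.

Lemma exp_adE S H : vanish_below 3 S -> vanish_below 2 H ->
  exp_ad S H = gexp id ('i \*o S) H.
Proof.
move=> S3 H2; have iS3 : vanish_below 3 ('i \*o S).
  by move=> m m3; rewrite /= S3// mulr0.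
have brE : bracket S = gbr ('i \*o S) by apply/funext => G; exact: bracketE.
apply/funext => m; rewrite /exp_ad brE /gexp.
rewrite (fsbig_ord _ _ (fun k => eterm id k ('i \*o S) H m)).
apply/esym/fsbig_widen => // k [_ /= /negP]; rewrite -leqNgt => mk.
by rewrite [RHS](_ : _ = eterm id k ('i \*o S) H m)//= eterm_vanish//;
  move: mk; clear; lia.
Qed.

(** Complex conjugate of the series, so that the reality condition reads [star F = F]. *)
Definition star F : series R := fun m => (F (bswap m))^*.

Lemma bswapK : involutive bswap.
Proof. by case. Qed.

Lemma star_gbr F G : star (gbr F G) = - gbr (star F) (star G).
Proof.
apply/funext => m; rewrite /star fctE.
have sub : (bdom (bswap m) `<=` [fset bswap p | p in bdom m])%fset.
  apply/fsubsetP => p; rewrite in_fset_set; last exact: (finite_bdom R).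
  move=> /set_mem[q nz]; apply/imfsetP; exists (bswap p); rewrite ?bswapK//=.
  have : cf (bswap p) (bswap q) m != 0 by rewrite -[m]bswapK cf_bswap oppr_eq0.
  by move=> /(mem_bdom R)/andP[].
have bI : injective bswap by exact: inv_inj bswapK.
rewrite (gbrE R _ _ sub sub) big_imfset /=; last by move=> p q _ _ /bI.
rewrite rmorph_sum /gbr -sumrN; apply: eq_bigr => p _.
rewrite big_imfset /=; last by move=> x y _ _ /bI.
rewrite rmorph_sum -sumrN; apply: eq_bigr => q _.
by rewrite !rmorphM /= rmorph_int cf_bswap mulrNz mulrN.
Qed.

(** Conjugating i compensates the sign in [star_gbr]. *)
Lemma star_bracket F G : star (gbr ('i \*o F) G) = gbr ('i \*o star F) (star G).
Proof.
have E : star ('i \*o F) = - ('i \*o star F).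
  apply/funext => m; change (('i * F (bswap m))^* = - ('i * star F m)).
  by rewrite rmorphM /= conjCi mulNr.
by rewrite star_gbr E [gbr (- _) _]gbrC gbrNr opprK -gbrC.
Qed.

Lemma star_gexp S H :
  star (gexp id ('i \*o S) H) = gexp id ('i \*o star S) (star H).
Proof.
apply/funext => m; rewrite /star /gexp rmorph_sum.
have -> : bdeg (bswap m) = bdeg m by rewrite /bdeg /= addnC.
apply: eq_bigr => k _; rewrite /eterm /= rmorphM /= fmorphV rmorph_nat.
congr (_ * _); rewrite -[LHS]/(star (iter k (gbr ('i \*o S)) H) m); congr (_ m).
by elim: (k : nat) => [//|j IH]; rewrite !iterS star_bracket IH.
Qed.

(** A degree-one monomial with index j <> 0 has nonzero momentum, so together with the three
    prescribed zeros nothing remains below degree 2. *)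
Lemma formal_hamP F : formal_ham F <->
  [/\ vanish_below 2 F, star F = F & forall m, momentum m <> 0 -> F m = 0].
Proof.
split=> [FH|[F2 Fs Fm]].
  have [_ F2] := formal_ham_low FH; case: FH => _ _ Fs Fm; split => //.
    by move=> m m2; apply: F2; rewrite add0n -ltnNge.
  by apply/funext => m; rewrite [RHS]Fs.
split => //.
- by apply: F2; rewrite /bdeg /= !mdeg1.
- by split; apply: F2; rewrite /bdeg /= mdegU mdeg1.
- by move=> m; rewrite -[in LHS]Fs.
Qed.

Lemma starD F G : star (F + G) = star F + star G.
Proof. by apply/funext => m; rewrite /star !fctE rmorphD. Qed.

Lemma starN F : star (- F) = - star F.
Proof. by apply/funext => m; rewrite /star !fctE rmorphN. Qed.

Lemma formal_hamD F G : formal_ham F -> formal_ham G -> formal_ham (F + G).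
Proof.
move=> /formal_hamP[F2 Fs Fm] /formal_hamP[G2 Gs Gm]; apply/formal_hamP; split.
- by move=> m m2; rewrite !fctE F2// G2// addr0.
- by rewrite starD Fs Gs.
- by move=> m m0; rewrite !fctE Fm// Gm// addr0.
Qed.

Lemma formal_hamN F : formal_ham F -> formal_ham (- F).
Proof.
move=> /formal_hamP[F2 Fs Fm]; apply/formal_hamP; split.
- by move=> m m2; rewrite !fctE F2// oppr0.
- by rewrite starN Fs.
- by move=> m m0; rewrite !fctE Fm// oppr0.
Qed.

Lemma formal_ham_geP (d : nat) F :
  formal_ham_ge d F <-> formal_ham F /\ vanish_below (d + 2) F.
Proof. by split=> -[F0 Fd]; split => // m; have := Fd m; rewrite -ltnNge. Qed.

Lemma formal_ham_exp_ad S H : formal_ham_ge 1 S -> formal_ham H ->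
  formal_ham (exp_ad S H).
Proof.
move=> /formal_ham_geP[/formal_hamP[_ Ss _] S3] /formal_hamP[H2 Hs Hm].
rewrite exp_adE//; apply/formal_hamP; split.
- have iS3 : vanish_below 3 ('i \*o S) by move=> m m3; rewrite /= S3// mulr0.
  move=> m m2; apply: big1 => k _; apply: eterm_vanish => //.
  by apply: leq_trans m2 _; exact: leq_addl.
- by rewrite star_gexp Ss Hs.
- by move=> m; exact: gexp_momentum.
Qed.

End Bridge.

(** * Normal form of a Hamiltonian D_w + Z + P *)

Section Hamiltonian.
Context (R : realType) (w : int -> R) (hw : nonresonant w).
Local Notation id := (idfun : {rmorphism R[i] -> R[i]}).
Context (d : nat) (d_gt0 : (1 <= d)%N) (H Z P : series R).
Hypothesis hZ : integrable_ham_ge 2 Z.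
Hypothesis hP : formal_ham_ge d P.
Hypothesis hH : H = quad_ham w + Z + P.

Lemma ham_formal : formal_ham H.
Proof.
case: hZ hP => -[FZ _] _ [FP _]; rewrite hH.
apply: formal_hamD => //; apply: formal_hamD => //.
by case: (quad_ham_integrable w).
Qed.

Lemma ham_quad m : bdeg m = 2%N -> H m = quad_ham w m.
Proof.
move=> m2; case: hZ hP => _ /formal_ham_geP[_ Z4] /formal_ham_geP[_ Pd].
rewrite hH -[LHS]/(quad_ham w m + Z m + P m) Z4 ?m2// Pd ?addr0//.
by rewrite m2; move: d_gt0; clear; lia.
Qed.

Lemma ham_offdiag m : (bdeg m < d + 2)%N -> m.1 <> m.2 -> H m = 0.
Proof.
move=> md mm; case: hZ hP => -[_ Z0] _ /formal_ham_geP[_ Pd].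
rewrite hH -[LHS]/(quad_ham w m + Z m + P m) Z0// Pd// !addr0.
by case: (quad_ham_integrable w) => _; apply.
Qed.

Lemma exists_normal_form : exists S Zt : series R, formal_ham_ge d S /\
  exp_ad S H = quad_ham w + Zt /\ integrable_ham_ge d (Zt - Z).
Proof.
have [H2 Hs Hm] := (formal_hamP H).1 ham_formal.
have Hq m : bdeg m = 2%N -> H m = id (quad_ham w m) by exact: ham_quad.
pose T := nf_gen w id H d (fun=> 0).
have Td : vanish_below (d + 2) T by exact: nf_gen_vanish.
have TH : offdiag_zero (gexp id T H).
  by apply: nf_gen_offdiag => // m; exact: ham_offdiag.
have Tm m : momentum m <> 0 -> T m = 0 by exact: nf_gen_momentum.
have T0 m : m.1 = m.2 -> T m = 0.
  move=> mm; have [/Td//|md] := ltnP (bdeg m) (d + 2).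
  by rewrite /T nf_gen_diag.
have T3 : vanish_below 3 T by exact: vanish_lt3 Td.
(* [exp_ad S] is [gexp] with generator i S, so S is T divided by i. *)
pose S : series R := (- 'i) \*o T.
have iS : 'i \*o S = T.
  by apply/funext => m; rewrite /S /= mulrA mulrN -expr2 sqrCi opprK mul1r.
have Sd : vanish_below (d + 2) S by move=> m md; rewrite /S /= Td// mulr0.
have bswap_deg m : bdeg (bswap m) = bdeg m by rewrite /bdeg /= addnC.
have stS3 : vanish_below 3 (star S).
  move=> m m3; rewrite /star /S /= T3 ?mulr0 ?rmorph0//.
  by rewrite bswap_deg.
(* Since H is real, e^{i star S} H is the conjugate of e^{i S} H and has no off-diagonal part
   either. Both generators have zero diagonal part, so uniqueness makes them equal. *)
have stS : 'i \*o star S = T.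
  apply: (gexp_offdiag_uniq (iota := id) hw H2 Hq) => //.
  - by move=> m m3; rewrite /= stS3// mulr0.
  - move=> m m0; rewrite /= /star /S /= Tm ?mulr0 ?rmorph0 ?mulr0//.
    by rewrite momentum_bswap => /eqP; rewrite oppr_eq0 => /eqP.
  - by move=> m mm; rewrite T0//= /star /S /= T0// mulr0 rmorph0 mulr0.
  - move=> m mm; rewrite -Hs -star_gexp iS /star TH ?rmorph0//.
    by move=> /esym.
have Ss : star S = S.
  apply/funext => m; apply: (mulfI (neq0Ci _)).
  by rewrite -[LHS]/(('i \*o star S) m) stS -iS.
have FS : formal_ham S.
  apply/formal_hamP; split => //.
    by move=> m m2; apply: Sd; move: m2; clear; lia.
  by move=> m m0; rewrite /S /= Tm// mulr0.
have S3 : vanish_below 3 S by exact: vanish_lt3 Sd.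
have S1 : formal_ham_ge 1 S by exact/formal_ham_geP.
have Fe := formal_ham_exp_ad S1 ham_formal.
case: (hZ) (hP) => -[FZ Z0] _ /formal_ham_geP[_ Pd].
have [FD D0] := quad_ham_integrable w.
have FZt : formal_ham (exp_ad S H - quad_ham w - Z).
  apply: formal_hamD (formal_hamN FZ); exact: formal_hamD (formal_hamN FD).
exists S, (exp_ad S H - quad_ham w); split; [|split].
- exact/formal_ham_geP.
- by rewrite addrC subrK.
split; [split => //|apply/formal_ham_geP; split => //].
  move=> m mm; rewrite exp_adE// iS -[LHS]/(gexp id T H m - quad_ham w m - Z m).
  by rewrite TH// D0// Z0// !subrr.
move=> m md; rewrite exp_adE// iS -[LHS]/(gexp id T H m - quad_ham w m - Z m).
(* Below degree d + 2 the exponential leaves H unchanged and P vanishes. *)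
rewrite (gexp_sub_vanish id d_gt0 Td H2 md) hH.
change (quad_ham w m + Z m + P m - quad_ham w m - Z m = 0).
by rewrite Pd// addr0 addrAC addrK subrr.
Qed.

Lemma normal_form_unique S G : formal_ham_ge 1 S -> formal_ham_ge 1 G ->
  offdiag_zero (exp_ad S H) -> offdiag_zero (exp_ad G H) ->
  exp_ad G H = exp_ad S H.
Proof.
move=> /formal_ham_geP[/formal_hamP[_ _ Sm] S3].
move=> /formal_ham_geP[/formal_hamP[_ _ Gm] G3].
have [H2 _ Hm] := (formal_hamP H).1 ham_formal.
rewrite !exp_adE// => SH GH.
have i3 (F : series R) : vanish_below 3 F -> vanish_below 3 ('i \*o F).
  by move=> F3 m m3; rewrite /= F3// mulr0.
have im (F : series R) : (forall m, momentum m <> 0 -> F m = 0) ->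
    forall m, momentum m <> 0 -> ('i \*o F) m = 0.
  by move=> Fm m m0; rewrite /= Fm// mulr0.
apply: (gexp_uniq hw H2 ham_quad Hm _ (i3 _ G3) (i3 _ S3)) => //; try exact: im.
by move=> m m3; apply: ham_offdiag; move: d_gt0 m3; clear; lia.
Qed.

End Hamiltonian.

Theorem proposition2p14 (R : realType) (w : int -> R) (hw : nonresonant w)
    (d : nat) (hd : (1 <= d)%N) (H Z P : series R)
    (hZ : integrable_ham_ge 2 Z) (hP : formal_ham_ge d P)
    (hH : H = (quad_ham w + Z + P)%R) :
  (exists S Zt : series R, formal_ham_ge d S /\
     exp_ad S H = (quad_ham w + Zt)%R /\ integrable_ham_ge d (Zt - Z)%R) /\
  (forall S Zt : series R, formal_ham_ge d S ->
     exp_ad S H = (quad_ham w + Zt)%R -> integrable_ham_ge d (Zt - Z)%R ->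
     forall G : series R, formal_ham_ge 1 G -> integrable_ham (exp_ad G H) ->
     exp_ad G H = exp_ad S H) /\
  (* Z_H depends on H only, not on its decomposition (d, Z, P) nor on S *)
  (exists! ZH : series R, integrable_ham_ge 2 ZH /\
     forall (d' : nat) (Z' P' S Zt : series R), (1 <= d')%N ->
       integrable_ham_ge 2 Z' -> formal_ham_ge d' P' ->
       H = (quad_ham w + Z' + P')%R ->
       formal_ham_ge d' S -> exp_ad S H = (quad_ham w + Zt)%R ->
       integrable_ham_ge d' (Zt - Z')%R ->
       exp_ad S H = (quad_ham w + ZH)%R).
Proof.
have ge1 (e : nat) (S : series R) : (1 <= e)%N -> formal_ham_ge e S ->
    formal_ham_ge 1 S.
  move=> e1 /formal_ham_geP[FS Se]; apply/formal_ham_geP; split => //.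
  exact: vanish_lt3 Se.
have offdiag (e : nat) (Y S Zt : series R) : integrable_ham_ge 2 Y ->
    exp_ad S H = quad_ham w + Zt -> integrable_ham_ge e (Zt - Y) ->
    offdiag_zero (exp_ad S H).
  move=> [[_ Y0] _] -> [[_ ZY0] _] m mm.
  have [_ D0] := quad_ham_integrable w.
  rewrite -[Zt](subrK Y) -[LHS]/(quad_ham w m + ((Zt - Y) m + Y m)).
  by rewrite D0// ZY0// Y0// !addr0.
have [S0 [Z0 [S0d [S0E Z0d]]]] := exists_normal_form hw hd hZ hP hH.
have uniq := normal_form_unique hw hd hZ hP hH.
split; [by exists S0, Z0|split].
  move=> S Zt Sd SE Ztd G G1 [_ GH].
  exact: (uniq S G (ge1 d S hd Sd) G1 (offdiag d Z S Zt hZ SE Ztd) GH).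
have S0H := offdiag d Z S0 Z0 hZ S0E Z0d.
(* Applying the characteristic property of a candidate [ZH] to the given decomposition and to S0
   yields [ZH] = Z0 after cancelling D_w. *)
exists Z0; split; last first.
  move=> ZH [_ /(_ d Z P S0 Z0 hd hZ hP hH S0d S0E Z0d)].
  by rewrite S0E => /addrI.
split; last first.
  (* Whatever d' is, S lies in F^{>=1} and removes the off-diagonal part of H, so [uniq] compares it
     with S0. *)
  move=> d' Z' P' S Zt d'1 hZ' hP' hH' Sd SE Ztd.
  rewrite -S0E; apply: uniq => //; [exact: ge1 S0d|exact: ge1 Sd|].
  exact: (offdiag d' Z' S Zt).
case: (hZ) => -[FZ ZZ] /formal_ham_geP[_ Z4].
case: Z0d => -[FY YY] /formal_ham_geP[_ Yd].
have FZ0 : formal_ham Z0 by rewrite -[Z0](subrK Z); exact: formal_hamD.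
have Z00 m : m.1 <> m.2 -> Z0 m = 0.
  by move=> mm; rewrite -[Z0](subrK Z) -[LHS]/((Z0 - Z) m + Z m) YY// ZZ// addr0.
split; first by split.
apply/formal_ham_geP; split => // m m4.
(* An integrable series has no monomial of odd degree. *)
have [mm|/Z00//] := pselect (m.1 = m.2).
rewrite -[Z0](subrK Z) -[LHS]/((Z0 - Z) m + Z m) Z4// addr0 Yd//.
by move: m4 hd; rewrite /bdeg mm; clear; lia.
Qed.
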